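(* Let $[X,Y]^{\top}$ be a random element of $L^2\times L^2$ that has mean zero and is jointly regularly varying with index $-\alpha$, where $\alpha>2$, and let $[X_1,Y_1]^{\top},[X_2,Y_2]^{\top},\ldots$ be independent copies of $[X,Y]^{\top}$. Let $k=k(n)$ satisfy $k\to\infty$ and $k/n\to0$ as $n\to\infty$. Put $R_i=\|X_i\|\vee\|Y_i\|$, let $R_{(k)}$ be the $k$th largest value among $R_1,\ldots,R_n$, and define $$\hat\rho_{n,k}=\frac{\sum_{i=1}^n\langle X_i,Y_i\rangle I_{R_i\ge R_{(k)}}}{\left(\sum_{i=1}^n\|X_i\|^2I_{R_i\ge R_{(k)}}\right)^{1/2}\left(\sum_{i=1}^n\|Y_i\|^2I_{R_i\ge R_{(k)}}\right)^{1/2}}.$$ Then $\hat\rho_{n,k}\to\rho_{XY}$ in probability as $n\to\infty$, where $\rho_{XY}$ is the extremal correlation coefficient of $X$ and $Y$.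
   Context: $L^2=L^2(\mathcal T)$, where $\mathcal T$ is a measure space such that $L^2(\mathcal T)$ is a separable real Hilbert space, with inner product $\langle x,y\rangle=\int_{\mathcal T}x(t)y(t)\,dt$ and norm $\|x\|=\langle x,x\rangle^{1/2}$. On $L^2\times L^2$ the norm is $\|(x,y)\|=\|x\|\vee\|y\|$. For a separable Banach space $\mathbb B$, $M_0(\mathbb B)$ is the set of Borel measures on $\mathbb B\setminus\{0\}$ that are finite on Borel sets bounded away from $0$ (sets disjoint from some open ball $\{z:\|z\|<\varepsilon\}$, $\varepsilon>0$). $\mu_n\to\mu$ in $M_0(\mathbb B)$ means $\mu_n(A)\to\mu(A)$ for every Borel set $A$ bounded away from $0$ with $\mu(\partial A)=0$. $[X,Y]^{\top}$ is jointly regularly varying in $L^2\times L^2$ with index $-\alpha$, $\alpha>0$, if there are a sequence $b(n)\to\infty$ and a measure $\mu\in M_0(L^2\times L^2)$ with $\mu(tA)=t^{-\alpha}\mu(A)$ for all $t>0$ and Borel $A$, such that $n\,\mathrm{pr}\big((X,Y)/b(n)\in\cdot\big)\to\mu$ in $M_0(L^2\times L^2)$. $\mu$ is called the joint exponent measure; it is normalized (by choice of $b(n)$) so that $\mu\{(x,y):\|x\|\vee\|y\|>1\}=1$. Standing assumption: both marginals $\mu_X(\cdot)=\mu(\cdot\times L^2)$ and $\mu_Y(\cdot)=\mu(L^2\times\cdot)$ on $L^2\setminus\{0\}$ are non-degenerate (nonzero measures in $M_0(L^2)$). The extremal correlation coefficient is $\rho_{XY}=\sigma_{XY}/(\sigma_X\sigma_Y)$,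 where $\sigma_{XY}=\int_{\|x\|\vee\|y\|>1}\langle x,y\rangle\,\mu(dx,dy)$, $\sigma_X=\big(\int_{\|x\|\vee\|y\|>1}\|x\|^2\mu(dx,dy)\big)^{1/2}$ and $\sigma_Y=\big(\int_{\|x\|\vee\|y\|>1}\|y\|^2\mu(dx,dy)\big)^{1/2}$. *)

(* Defs.v *)
From HB Require Import structures.
From mathcomp Require Import all_boot all_order all_algebra.
From mathcomp Require Import all_classical all_reals all_analysis.
From mathcomp Require Import measurable_realfun.
Import Order.TTheory GRing.Theory Num.Theory numFieldNormedType.Exports.

Set Implicit Arguments.
Unset Strict Implicit.
Unset Printing Implicit Defensive.

Local Open Scope classical_set_scope.
Local Open Scope ring_scope.

(* The elements are classes of measurable functions modulo nu-a.e. equality; the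
   normed-module structure, missing from the library, is set up below. *)
Definition L2 d (T : measurableType d) (R : realType)
  (nu : {measure set T -> \bar R}) : Type := LspaceType2 nu.

Section L2_space.
Context d (T : measurableType d) (R : realType).
Variable nu : {measure set T -> \bar R}.

Local Notation Lf := (LfunType nu (lee1n 2)).
Local Notation L2 := (L2 nu).

(* A class is applied through its canonical representative. *)
Definition L2val (f : L2) : T -> R :=
  (f : {mfun_ nu, T >-> measurableTypeR R}).
Coercion L2val : L2 >-> Funclass.

HB.instance Definition _ := gen_eqMixin L2.
HB.instance Definition _ := gen_choiceMixin L2.

Let mfun_quot_measurable (q : {mfun_ nu, T >-> measurableTypeR R}) :
  measurable_fun setT (q : T -> R).
Proof. exact: (@measurable_funPT _ _ _ _ (repr q)). Qed.

Lemma L2val_measurable (f : L2) : measurable_fun setT (f : T -> R).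
Proof. exact: mfun_quot_measurable. Qed.

Lemma L2valP (f : L2) : (f : T -> R) \in Lfun nu 2%:E.
Proof.
rewrite inE; apply/andP; split; first by rewrite inE; exact: L2val_measurable.
by rewrite inE; exact: (@Lebesgue_finite _ _ _ _ _ _ f).
Qed.

Lemma L2_eqP (f g : L2) : f = g <-> (f : T -> R) = g %[ae nu].
Proof.
split=> [->|]; first exact: ae_eq_refl.
case: f g => [f [[Pf]]] [g [[Pg]]] fg.
have {fg} E : f = g by rewrite -[f]reprK -[g]reprK; exact/eqP/ae_eqP.
by subst g; rewrite (Prop_irrelevance Pf Pg).
Qed.

Lemma ae_Lnorm2 (f g : T -> R) :
    measurable_fun setT f -> measurable_fun setT g -> f = g %[ae nu] ->
  'N[nu]_2%:E [EFin \o f]%E = 'N[nu]_2%:E [EFin \o g]%E.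
Proof.
move=> mf mg fg; rewrite unlock; congr (_ `^ _)%E.
apply: ae_eq_integral => //.
- apply: (@measurableT_comp _ _ _ _ _ _ (fun x : \bar R => x `^ 2)%E) => //=.
    exact: measurable_poweR.
  by apply/measurable_EFinP; exact: measurableT_comp.
- apply: (@measurableT_comp _ _ _ _ _ _ (fun x : \bar R => x `^ 2)%E) => //=.
    exact: measurable_poweR.
  by apply/measurable_EFinP; exact: measurableT_comp.
by apply: filterS fg => x /(_ I) /= ->.
Qed.

Let mfun_of_Lf (f : Lf) : {mfun T >-> measurableTypeR R} :=
  @mfun_Sub _ _ T (measurableTypeR R) f (sub_Lfun_mfun (LfunP f)).

Let L2class_quot (f : Lf) : {mfun_ nu, T >-> measurableTypeR R} :=
  \pi_({mfun_ nu, T >-> measurableTypeR R})%qT (mfun_of_Lf f).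

Let L2class_quotE (f : Lf) : (L2class_quot f : T -> R) = f %[ae nu].
Proof.
have /eqP := reprK (L2class_quot f).
by rewrite eqmodE => /asboolP.
Qed.

Let L2class_subproof (f : Lf) : finite_norm nu 2%:E (L2class_quot f).
Proof.
by rewrite /finite_norm (@ae_Lnorm2 _ f) //; exact: Lfunction_finite.
Qed.

Definition L2class (f : Lf) : L2 :=
  @LebesgueSpace.Pack _ _ _ nu _ (lee1n 2) (L2class_quot f)
    (LebesgueSpace.Class
      (@isFinLebesgue.Axioms_ _ _ _ _ _ _ _
        (L2class_subproof f))).

Lemma L2classE (f : Lf) : (L2class f : T -> R) = f %[ae nu].
Proof. exact: L2class_quotE. Qed.

Let Lsub (f : L2) : Lf := Lfun_Sub (lee1n 2) (L2valP f).

Definition L2zero : L2 := L2class (0 : Lf).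
Definition L2add (f g : L2) : L2 := L2class (Lsub f + Lsub g).
Definition L2opp (f : L2) : L2 := L2class (- Lsub f).
Definition L2scale (a : R) (f : L2) : L2 := L2class (a *: Lsub f).

Lemma L2zeroE : (L2zero : T -> R) = cst 0 %[ae nu].
Proof. exact: L2classE. Qed.

Lemma L2addE f g : (L2add f g : T -> R) = f \+ g %[ae nu].
Proof. exact: L2classE. Qed.

Lemma L2oppE f : (L2opp f : T -> R) = \- f %[ae nu].
Proof. exact: L2classE. Qed.

Lemma L2scaleE a f : (L2scale a f : T -> R) = (fun t => a * f t) %[ae nu].
Proof. exact: L2classE. Qed.

Lemma L2addA : associative L2add.
Proof.
move=> f g h; apply/L2_eqP.
apply: filterS3 (L2addE f (L2add g h)) (L2addE g h)
  (filterI (L2addE (L2add f g) h) (L2addE f g)) => t E1 E2 [E3 E4] _.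
by rewrite E1//= E2//= E3//= E4//= addrA.
Qed.

Lemma L2addC : commutative L2add.
Proof.
move=> f g; apply/L2_eqP.
apply: filterS2 (L2addE f g) (L2addE g f) => t E1 E2 _.
by rewrite E1//= E2//= addrC.
Qed.

Lemma L2add0 : left_id L2zero L2add.
Proof.
move=> f; apply/L2_eqP.
apply: filterS2 (L2addE L2zero f) L2zeroE => t E1 E2 _.
by rewrite E1//= E2//= add0r.
Qed.

Lemma L2addN : left_inverse L2zero L2opp L2add.
Proof.
move=> f; apply/L2_eqP.
apply: filterS3 (L2addE (L2opp f) f) L2zeroE
  (L2oppE f) => t E1 E2 E3 _.
by rewrite E1//= E2//= E3//= addNr.
Qed.

HB.instance Definition _ :=
  GRing.isZmodule.Build L2 L2addA L2addC L2add0 L2addN.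

Lemma L2scaleA a b f : L2scale a (L2scale b f) = L2scale (a * b) f.
Proof.
apply/L2_eqP.
apply: filterS3 (L2scaleE a (L2scale b f)) (L2scaleE b f)
  (L2scaleE (a * b) f) => t E1 E2 E3 _.
by rewrite E1//= E2//= E3//= mulrA.
Qed.

Lemma L2scale1 : left_id 1 L2scale.
Proof.
move=> f; apply/L2_eqP.
by apply: filterS (L2scaleE 1 f) => t E1 _; rewrite E1//= mul1r.
Qed.

Lemma L2scaleDr : right_distributive L2scale +%R.
Proof.
move=> a f g; apply/L2_eqP.
apply: filterS3 (L2scaleE a (L2add f g))
  (filterI (L2addE f g) (L2scaleE a f))
  (filterI (L2scaleE a g) (L2addE (L2scale a f) (L2scale a g)))
  => t E1 [E2 E3] [E4 E5] _.
by rewrite E1//= E2//= E5//= E3//= E4//= mulrDr.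
Qed.

Lemma L2scaleDl f : {morph L2scale^~ f : a b / a + b}.
Proof.
move=> a b; apply/L2_eqP.
apply: filterS3 (L2scaleE (a + b) f) (L2scaleE a f)
  (filterI (L2scaleE b f) (L2addE (L2scale a f) (L2scale b f)))
  => t E1 E2 [E3 E4] _.
by rewrite E1//= E4//= E2//= E3//= mulrDl.
Qed.

HB.instance Definition _ := GRing.Zmodule_isLmodule.Build R L2
  L2scaleA L2scale1 L2scaleDr L2scaleDl.

Definition L2norm (f : L2) : R := fine ('N[nu]_2%:E [EFin \o f])%E.

Let L2normE_ae (f : L2) (g : Lf) : (f : T -> R) = g %[ae nu] ->
  L2norm f = fine ('N[nu]_2%:E [EFin \o g])%E.
Proof.
move=> fg; congr fine; apply: ae_Lnorm2 => //; exact: L2val_measurable.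
Qed.

Lemma L2normD f g : L2norm (f + g) <= L2norm f + L2norm g.
Proof.
rewrite (@L2normE_ae _ (Lsub f + Lsub g)); last exact: L2addE.
exact: (@ler_LnormD _ _ _ _ _ _ (Lsub f) (Lsub g)).
Qed.

Lemma L2normZ a f : L2norm (a *: f) = `|a| * L2norm f.
Proof.
rewrite (@L2normE_ae _ (a *: Lsub f)); last exact: L2scaleE.
rewrite (_ : 'N[nu]_2%:E [EFin \o (a *: Lsub f)]%E =
  (`|a|%:E * 'N[nu]_2%:E [EFin \o Lsub f])%E); last exact: LnormZ.
by rewrite -[X in (_ * X)%E](finite_norm_fine (Lsub f)).
Qed.

Lemma L2norm_eq0 f : L2norm f = 0 -> f = 0.
Proof.
move=> /(@fine_Lnormr_eq0 _ _ _ _ _ _ (Lsub f)) f0; apply/L2_eqP.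
apply: filterS2 f0 L2zeroE => t E1 E2 _.
by rewrite [RHS]E2//; exact: E1.
Qed.

HB.instance Definition _ := @Lmodule_isNormed.Build R L2
  L2norm L2normD L2normZ L2norm_eq0.

Definition L2inner (f g : L2) : R := (\int[nu]_t (f t * g t))%R.

Lemma L2_normE (f : L2) : `|f| = Num.sqrt (L2inner f f).
Proof.
rewrite -[LHS]/(L2norm f) /L2norm unlock /L2inner /Rintegral.
rewrite (_ : (\int[nu]_t (`|(EFin \o f) t| `^ 2))%E =
             (\int[nu]_t (f t * f t)%:E)%E); last first.
  apply: eq_integral => t _ /=.
  by rewrite powR_mulrn// real_normK ?num_real// expr2.
rewrite poweR12_sqrt; last first.
  by apply: integral_ge0 => t _; rewrite lee_fin -expr2 sqr_ge0.
by case: (\int[nu]_t _)%E => //=; rewrite sqrtr0.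
Qed.

End L2_space.

Definition separable_space (V : topologicalType) : Prop :=
  exists2 D : set V, countable D & dense D.

Definition borel_type (R : realType) (V : normedModType R) :=
  g_sigma_algebraType (@open V).

Section regular_variation.
Context (R : realType) (V : normedModType R).

Definition bounded_away (A : set V) : Prop :=
  exists2 e : R, 0 < e & A `&` [set z | `|z| < e] = set0.

(* A measure on V \ {0} is represented by the measure on V that extends it by
   giving mass 0 to {0}. *)
Definition M0 (mu : set (borel_type V) -> \bar R) : Prop :=
  mu [set 0] = 0%E /\
  forall A : set (borel_type V), measurable A -> bounded_away A -> (mu A < +oo)%E.

Definition cvg_M0 (mu_ : nat -> set (borel_type V) -> \bar R)
    (mu : set (borel_type V) -> \bar R) : Prop :=
  forall A : set V, measurable (A : set (borel_type V)) -> bounded_away A ->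
    mu (closure A `\` interior A) = 0%E -> mu_ n A @[n --> \oo] --> mu A.

Definition regularly_varying d (Omega : measurableType d)
    (P : probability Omega R) (Z : Omega -> V) (alpha : R) (b : nat -> R)
    (mu : {measure set (borel_type V) -> \bar R}) : Prop :=
  [/\ 0 < alpha,
      b n @[n --> \oo] --> +oo,
      M0 mu,
      (forall (t : R) (A : set (borel_type V)), 0 < t -> measurable A ->
        mu [set t *: (z : V) | z in A] = ((t `^ (- alpha))%:E * mu A)%E)
    & cvg_M0 (fun n A => n%:R%:E * P [set w | A ((b n)^-1 *: Z w)])%E mu].

End regular_variation.

Section extremal_correlation.
Context dT (T : measurableType dT) (R : realType).
Variable nu : {measure set T -> \bar R}.

Local Notation H := (L2 nu).
Local Notation HH := (L2 nu * L2 nu)%type.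

(* This is also the norm of the product normed module L^2 x L^2. *)
Definition maxnorm (z : HH) : R := Num.max `|z.1| `|z.2|.

(* The marginals of mu on L^2 \ {0}, again extended by mass 0 at 0 (mu may
   charge {0} x L^2, even with infinite mass). *)
Definition marginalX (mu : set (borel_type HH) -> \bar R) (A : set (borel_type H)) :=
  mu [set z : HH | A z.1 /\ z.1 != 0].
Definition marginalY (mu : set (borel_type HH) -> \bar R) (A : set (borel_type H)) :=
  mu [set z : HH | A z.2 /\ z.2 != 0].

Definition nondegenerate_M0 (m : set (borel_type H) -> \bar R) : Prop :=
  M0 m /\ exists2 A : set (borel_type H), measurable A & m A <> 0%E.

Section exponent_measure.
Variable mu : {measure set (borel_type HH) -> \bar R}.

Local Notation extreme := [set z : HH | 1 < maxnorm z].

Definition sigma_XY : R :=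
  \int[mu]_(z in extreme) L2inner (z : HH).1 (z : HH).2.
Definition sigma_X : R :=
  Num.sqrt (\int[mu]_(z in extreme) (`|(z : HH).1| ^+ 2)).
Definition sigma_Y : R :=
  Num.sqrt (\int[mu]_(z in extreme) (`|(z : HH).2| ^+ 2)).
Definition extremal_corr : R := sigma_XY / (sigma_X * sigma_Y).

End exponent_measure.

(* The k-th largest element for k >= 1, counted with multiplicity. *)
Definition kth_largest (k : nat) (s : seq R) : R := nth 0 (sort >=%R s) k.-1.

(* The sample z_1, ..., z_n is indexed from 0. The quotient is 0 when the
   denominator vanishes. *)
Definition rho_hat (n k : nat) (z : nat -> HH) : R :=
  let Rk := kth_largest k [seq maxnorm (z i) | i <- iota 0 n] in
  (\sum_(0 <= i < n | Rk <= maxnorm (z i)) L2inner (z i).1 (z i).2) /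
  (Num.sqrt (\sum_(0 <= i < n | Rk <= maxnorm (z i)) `|(z i).1| ^+ 2) *
   Num.sqrt (\sum_(0 <= i < n | Rk <= maxnorm (z i)) `|(z i).2| ^+ 2)).

Section random_elements.
Context d (Omega : measurableType d) (P : probability Omega R).

(* The mean of X is the m with E<X, h> = <m, h> for every h, provided
   E||X|| < oo. *)
Definition has_mean (X : Omega -> H) (m : H) : Prop :=
  P.-integrable setT (fun w => `|X w|%:E) /\
  forall h : H, ('E_P[fun w => L2inner (X w) h] = (L2inner m h)%:E)%E.

End random_elements.
End extremal_correlation.

Section independent_copies.
Context d (Omega : measurableType d) d' (E : measurableType d') (R : realType).
Variable P : probability Omega R.

Definition mutually_independent (Z_ : nat -> Omega -> E) : Prop :=
  forall (J : seq nat) (A : nat -> set E),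
    uniq J -> (forall i, measurable (A i)) ->
    P (\bigcap_(i in [set` J]) (Z_ i @^-1` A i)) =
    (\prod_(i <- J) P (Z_ i @^-1` A i))%E.

Definition independent_copies (Z_ : nat -> Omega -> E) (Z : Omega -> E) :=
  [/\ forall i, measurable_fun setT (Z_ i),
      forall i (A : set E), measurable A -> P (Z_ i @^-1` A) = P (Z @^-1` A)
    & mutually_independent Z_].

Definition cvg_in_probability (f_ : nat -> Omega -> R) (c : R) : Prop :=
  forall e : R, 0 < e -> P [set w | e < `|f_ n w - c|] @[n --> \oo] --> 0%E.

End independent_copies.

(* Main.v *)
Require Import Defs.
From HB Require Import structures.
From mathcomp Require Import all_boot all_order all_algebra.
From mathcomp Require Import all_classical all_reals all_analysis.
From mathcomp Require Import measurable_realfun.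
From mathcomp Require Import lra ring.
Import Order.TTheory GRing.Theory Num.Theory numFieldNormedType.Exports.

Local Open Scope classical_set_scope.
Local Open Scope ring_scope.

(** Write Z_i = (X_i, Y_i) and s = b (n %/ k n), and let the tail mean of a function
    f be (1/k) times the sum of f (Z_i / s) over i < n.  The estimator is invariant
    under a common rescaling of the sample, so it is the ratio built from three sums
    over the k largest observations, each divided by k s^2: those of <x, y>, |x|^2
    and |y|^2.  It suffices that each of them converges in probability to the integral
    of the same function over {|z| > 1} against mu, and that the last two integrals
    are positive (the marginals are nondegenerate and mu is homogeneous).  The three
    functions are continuous, homogeneous of degree 2 and bounded by |z|^2; nothing
    else about L^2 matters, so the limit theorem [top_sum_whp] is proved in an
    arbitrary normed module.

    Indicators.  If A is bounded away from 0 and has a mu-null boundary, the tail mean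
    of 1_A has expectation (n/k) pr(Z/s in A), which tends to mu A, and a variance of
    order 1/k, because k tends to infinity and the copies are independent
    ([count_concentration], [tail_mean_indic]).  Superlevel sets of a homogeneous function
    have null boundaries: shrinking {g > c} by a factor close to 1 covers
    {g >= c} and hardly changes the mass ([mu_level_null]).

    Unbounded functions.  A nonnegative g restricted to {|z| > 1} is squeezed between
    a finite sum of indicators of superlevel sets, in steps of height theta, and the
    same sum plus theta 1{|z| > 1} + |z|^2 1{|z| > M}.  The last term is uniformly
    small in mean, and this is where alpha > 2 enters: the tail F of |Z| satisfies
    F (2x) <= c F x for large x with 4c < 1 ([tail_halving]), so the contributions of
    the dyadic shells to the second moment form a convergent geometric series
    ([second_moment_tail]).  Markov's inequality then bounds the error.

    Random threshold.  For t1 < 1 < t2, about k t1^-alpha > k observations exceed t1 s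
    and about k t2^-alpha < k exceed t2 s, so the k-th largest norm lies between t1 s
    and t2 s.  Replacing it by s affects only the observations in between; there are
    about k (t1^-alpha - t2^-alpha) of them, and each contributes at most t2^2 s^2
    ([top_sum_approx]). *)

Set Implicit Arguments.
Unset Strict Implicit.

(** * Borel measurability of continuous maps *)

Section borel.
Context (R : realType) (V : normedModType R).

Lemma open_borel (A : set V) : open A -> measurable (A : set (borel_type V)).
Proof. by move=> oA; apply: sub_sigma_algebra. Qed.

Lemma closed_borel (A : set V) : closed A -> measurable (A : set (borel_type V)).
Proof.
by move=> cA; rewrite -[A]setCK; apply: measurableC; apply: open_borel; exact: closed_openC.
Qed.

Lemma continuous_borel_measurable (f : V -> R) : continuous f ->
  measurable_fun setT (f : borel_type V -> R).
Proof.
move=> /continuousP cf.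
apply: (measurability _ (RGenOInfty.measurableE R)).
move=> _ [_ [x ->] <-]; rewrite setTI; apply: open_borel; apply: cf.
by rewrite set_itvE; exact: open_gt.
Qed.

Lemma continuous_borel_measurable_to (W : normedModType R) (f : V -> W) : continuous f ->
  measurable_fun setT (f : borel_type V -> borel_type W).
Proof.
move=> /continuousP cf.
apply: (@measurability _ _ (borel_type V) (borel_type W) setT _ (@open W) erefl).
by move=> _ [A oA <-]; rewrite setTI; apply: open_borel; exact: cf.
Qed.

Lemma scale_borel_measurable (a : R) :
  measurable_fun setT ((fun z => a *: (z : V)) : borel_type V -> borel_type V).
Proof. by apply: continuous_borel_measurable_to; exact: scaler_continuous. Qed.

End borel.

(** * Markov and Chebyshev inequalities *)

Section concentration.
Context d (Omega : measurableType d) (R : realType).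

Lemma ge0_integral_real_sum (P : {measure set Omega -> \bar R}) (I : Type) (s : seq I)
    (h : I -> Omega -> R) :
  (forall i, measurable_fun setT (h i)) -> (forall i w, 0 <= h i w) ->
  (\int[P]_w (\sum_(i <- s) h i w)%:E = \sum_(i <- s) \int[P]_w (h i w)%:E)%E.
Proof.
move=> mh h0; under eq_integral do rewrite -sumEFin.
rewrite ge0_integral_sum// => i; first exact/measurable_EFinP.
by move=> w _; rewrite lee_fin.
Qed.

Lemma markov_set (P : {measure set Omega -> \bar R}) (h : Omega -> R)
    (A : set Omega) (e : R) :
  measurable_fun setT h -> (forall w, 0 <= h w) -> measurable A -> 0 <= e ->
  (forall w, A w -> e <= h w) -> (e%:E * P A <= \int[P]_w (h w)%:E)%E.
Proof.
move=> mh h0 mA e0 eh.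
rewrite -integral_cst//.
apply: (@le_trans _ _ (\int[P]_(w in A) (h w)%:E)%E).
  apply: ge0_le_integral => //.
  by apply/measurable_EFinP; exact: measurable_funTS.
apply: ge0_subset_integral => //.
  exact/measurable_EFinP.
by move=> w _; rewrite lee_fin.
Qed.

Lemma measurable_gtr (f : Omega -> R) (e : R) : measurable_fun setT f ->
  measurable [set w | e < f w].
Proof.
move=> mf; have := measurable_fun_ltr (@measurable_cst _ _ _ _ setT e) mf.
move=> /(_ measurableT [set true] I); rewrite setTI.
by rewrite (_ : _ @^-1` _ = [set w | e < f w]).
Qed.

Variable P : probability Omega R.

(** Pairwise independence gives the count a variance of at most its mean n p; the
    second moment is computed from the events E i and E i `&` E j, so that only
    nonnegative integrals occur. *)
Lemma count_concentration (n : nat) (E : nat -> set Omega) (p e : R) :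
  (forall i, measurable (E i)) -> (forall i, P (E i) = p%:E) ->
  (forall i j, i != j -> P (E i `&` E j) = (p ^+ 2)%:E) -> 0 < e ->
  (P [set w | (e < `|\sum_(0 <= i < n) \1_(E i) w - n%:R * p|)%R] <=
   (n%:R * p / e ^+ 2)%:E)%E.
Proof.
move=> mE PE PEE e0.
have p0 : 0 <= p by rewrite -lee_fin -(PE 0%N).
pose N w : R := \sum_(0 <= i < n) \1_(E i) w.
have mi A : measurable A -> measurable_fun setT (\1_A : Omega -> R).
  by move=> mA; exact: measurable_indic.
have mN : measurable_fun setT N by apply: measurable_sum => i; exact: mi.
have N0 w : 0 <= N w by apply: sumr_ge0 => i _; rewrite indicE.
pose c : R := n%:R * p.
have c0 : 0 <= c by rewrite mulr_ge0.
have intN : (\int[P]_w (N w)%:E = c%:E)%E.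
  rewrite ge0_integral_real_sum//; last by move=> i; exact: mi.
  rewrite (eq_bigr (fun=> p%:E)) => [|i _]; last by rewrite integral_indic ?setIT//; exact: PE.
  by rewrite sumEFin sumr_const_nat subn0 /c mulr_natl.
have intNN : (\int[P]_w (N w ^+ 2)%:E <= (c ^+ 2 + c)%:E)%E.
  have -> : (fun w => (N w ^+ 2)%:E) =
      (fun w => (\sum_(0 <= i < n) \sum_(0 <= j < n) \1_(E i `&` E j) w)%:E).
    apply/funext => w; congr EFin; rewrite expr2 /N big_distrl/=.
    apply: eq_bigr => i _; rewrite big_distrr/=; apply: eq_bigr => j _.
    by rewrite indicI.
  rewrite ge0_integral_real_sum; last 2 first.
  - by move=> i; apply: measurable_sum => j; apply: mi; exact: measurableI.
  - by move=> i w; apply: sumr_ge0 => j _; rewrite indicE.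
  have -> : c ^+ 2 + c = \sum_(0 <= i < n) (c * p + p).
    by rewrite sumr_const_nat subn0 /c -mulr_natl; ring.
  rewrite -sumEFin; apply: lee_sum => i _.
  rewrite ge0_integral_real_sum//; last by move=> j; apply: mi; exact: measurableI.
  rewrite (eq_bigr (fun j => P (E i `&` E j))) => [|j _]; last first.
    by rewrite integral_indic ?setIT//; exact: measurableI.
  apply: (@le_trans _ _ (\sum_(0 <= j < n) (p ^+ 2 + if j == i then p else 0)%:E)%E).
    apply: lee_sum => j _; have [->|ji] := eqVneq j i.
      by rewrite setIid PE lee_fin lerDr sqr_ge0.
    by rewrite PEE 1?eq_sym// addr0.
  rewrite sumEFin lee_fin big_split/= sumr_const_nat subn0 -mulr_natl.
  rewrite -big_mkcond/= big_nat1_eq lerD//; first by rewrite /c expr2 mulrA.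
  by case: ifP.
have mQ : measurable_fun setT (fun w => (N w - c) ^+ 2).
  by apply: measurable_funX; exact: measurable_funB.
have mN2 : measurable_fun setT (fun w => N w ^+ 2) by exact: measurable_funX.
have intQ : (\int[P]_w ((N w - c) ^+ 2)%:E <= c%:E)%E.
  have : (\int[P]_w ((N w - c) ^+ 2)%:E + \int[P]_w (2 * c * N w)%:E =
          \int[P]_w (N w ^+ 2)%:E + \int[P]_w (c ^+ 2)%:E)%E.
    rewrite -!ge0_integralD//=.
    - by apply: eq_integral => w _; rewrite -!EFinD; congr EFin; ring.
    - by move=> w _; rewrite lee_fin sqr_ge0.
    - exact/measurable_EFinP.
    - by move=> w _; rewrite lee_fin sqr_ge0.
    - by move=> w _; rewrite lee_fin sqr_ge0.
    - exact/measurable_EFinP.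
    - by move=> w _; rewrite lee_fin !mulr_ge0.
    - by apply/measurable_EFinP; exact: measurable_funM.
  under [X in (_ + X)%E = _]eq_integral do rewrite EFinM.
  rewrite ge0_integralZl_EFin ?mulr_ge0//; last 2 first.
  - by move=> w _; rewrite lee_fin.
  - exact/measurable_EFinP.
  rewrite intN integral_cst// => H0.
  have H : (\int[P]_w ((N w - c) ^+ 2)%:E + (2 * c)%:E * c%:E =
          \int[P]_w (N w ^+ 2)%:E + (c ^+ 2)%:E)%E.
    by rewrite H0; congr adde; rewrite -[RHS]mule1; congr mule; exact: probability_setT.
  have : (\int[P]_w ((N w - c) ^+ 2)%:E + (2 * c * c)%:E <= (c ^+ 2 + c)%:E + (c ^+ 2)%:E)%E.
    by rewrite EFinM H leeD2r.
  rewrite -leeBrDr// => /le_trans; apply.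
  by rewrite -!EFinD lee_fin; lra.
have mNc : measurable_fun setT (fun w => `|N w - c|).
  by apply: measurableT_comp => //; exact: measurable_funB.
have : ((e ^+ 2)%:E * P [set w | (e < `|N w - c|)%R] <= c%:E)%E.
  apply: le_trans intQ; apply: markov_set => //; last 2 first.
  - exact: sqr_ge0.
  - by move=> w /= ew; rewrite -(real_normK (num_real (N w - c))) lerXn2r ?nnegrE// ltW.
  - by move=> w; exact: sqr_ge0.
  - exact: measurable_gtr.
by rewrite muleC -lee_pdivlMr ?exprn_gt0// EFinM.
Qed.

End concentration.

(** * Homogeneous measures *)

Section homogeneous_measure.
Context (R : realType) (V : normedModType R).
Implicit Types (g : V -> R) (p : nat).

Definition homogeneous p g := forall (t : R) (z : V), 0 < t -> g (t *: z) = t ^+ p * g z.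

Lemma homogeneous_norm : homogeneous 1 (fun z : V => `|z|).
Proof. by move=> t z t0; rewrite normrZ gtr0_norm// expr1. Qed.

Variables (mu : {measure set (borel_type V) -> \bar R}) (alpha : R).
Hypothesis alpha_gt0 : 0 < alpha.
Hypothesis mu_homogeneous : forall (t : R) (A : set (borel_type V)), 0 < t -> measurable A ->
  mu [set t *: (z : V) | z in A] = ((t `^ (- alpha))%:E * mu A)%E.

Lemma measurable_superlevel g c : continuous g ->
  measurable ([set z | c < g z] : set (borel_type V)).
Proof. by move=> cg; apply: measurable_gtr; exact: continuous_borel_measurable. Qed.

Lemma mu_superlevel g p c (t : R) : continuous g -> homogeneous p g -> 0 < t ->
  mu [set z | (t ^+ p * c < g z)%R] = ((t `^ (- alpha))%:E * mu [set z | (c < g z)%R])%E.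
Proof.
move=> cg hg t0; rewrite -mu_homogeneous//; last exact: measurable_superlevel.
congr (mu _); apply/seteqP; split => z /= cz.
  exists (t^-1 *: (z : V)); last by rewrite scalerA divff ?gt_eqF// scale1r.
  by rewrite hg ?invr_gt0// exprVn mulrC ltr_pdivlMr ?exprn_gt0// mulrC.
by case: cz => y cy <-; rewrite hg// ltr_pM2l// exprn_gt0.
Qed.

(** By homogeneity {g > t^p c} has mass t^-alpha times that of {g > c}, and for t < 1
    it contains {g >= c}; as t tends to 1, {g >= c} has no more mass than {g > c}. *)
Lemma mu_level_null g p c : continuous g -> homogeneous p g -> (0 < p)%N -> 0 < c ->
  (mu [set z | (c < g z)%R] < +oo)%E -> mu [set z | (g z = c)%R] = 0%E.
Proof.
move=> cg hg p0 c0 fin.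
have mg := measurable_superlevel c cg.
have mge : measurable ([set z | c <= g z] : set (borel_type V)).
  apply: closed_borel; rewrite (_ : [set z | _] = g @^-1` [set x | c <= x])//.
  by move/continuous_closedP : cg; apply; exact: closed_ge.
have me : measurable ([set z | g z = c] : set (borel_type V)).
  rewrite (_ : [set z | g z = c] = [set z | c <= g z] `\` [set z | c < g z]).
    exact: measurableD.
  apply/seteqP; split => z /=; first by move=> ->; rewrite lexx ltxx.
  by move=> [cz /negP]; rewrite -leNgt => zc; apply/eqP; rewrite eq_le cz zc.
have ge_le : (mu [set z | (c <= g z)%R] <= mu [set z | (c < g z)%R])%E.
  apply/lee_mul01Pr => // s /andP[s0 s1].
  pose t := s `^ alpha^-1.
  have t0 : 0 < t by rewrite powR_gt0.
  have t1 : t < 1.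
    have := @gt0_ltr_powR R alpha^-1; rewrite invr_gt0 => /(_ alpha_gt0 s 1).
    by rewrite powR1 !nnegrE ltW//; apply.
  have st : t `^ (- alpha) = s^-1.
    by rewrite -powRrM mulrN mulVf ?gt_eqF// powR_inv1// ltW.
  rewrite -[leRHS]mul1e -(@mulfV _ s) ?gt_eqF// EFinM -muleA lee_pmul2l//.
  rewrite -st -(mu_superlevel c cg hg t0); apply: le_measure; rewrite ?inE//.
    exact: measurable_superlevel.
  move=> z /= cz; apply: lt_le_trans cz.
  by rewrite gtr_pMl// exprn_ilt1 ?ltW// -lt0n.
have : (mu [set z | (c < g z)%R] + mu [set z | (g z = c)%R] <= mu [set z | (c < g z)%R])%E.
  apply: le_trans ge_le; rewrite -measureU//; last first.
    by apply/seteqP; split => z //= -[+ zc]; rewrite zc ltxx.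
  apply: le_measure; rewrite ?inE//; first exact: measurableU.
  by move=> z /= [/ltW//|->].
rewrite -[leRHS]adde0 leeD2lE ?ge0_fin_numE//.
by move=> h; apply/eqP; rewrite eq_le h measure_ge0.
Qed.

(** {g > 0} is the countable union of the sets {g > 1/j}, which are dilations of
    {g > 1}. *)
Lemma mu_positive_null g : continuous g -> homogeneous 1 g ->
  mu [set z | (1 < g z)%R] = 0%E -> mu [set z | (0 < g z)%R] = 0%E.
Proof.
move=> cg hg g1.
have -> : [set z | 0 < g z] = \bigcup_j [set z | j.+1%:R^-1 < g z].
  apply/seteqP; split => z /=; last by move=> [j _]; exact: lt_trans.
  move=> gz; exists (Num.truncn (g z)^-1) => //=.
  by rewrite -[ltRHS]invrK ltf_pV2 ?posrE ?invr_gt0// truncnS_gt.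
apply/eqP; rewrite eq_le measure_ge0 andbT.
have mF j : measurable ([set z | j.+1%:R^-1 < g z] : set (borel_type V)).
  exact: measurable_superlevel.
apply: le_trans (measure_sigma_subadditive mu mF
  (bigcup_measurable (fun j _ => mF j)) (@subset_refl _ _)) _.
rewrite eseries0// => j _ _.
have := mu_superlevel 1 cg hg (t := j.+1%:R^-1); rewrite expr1 mulr1 => -> //.
by rewrite g1 mule0.
Qed.

Hypothesis mu_outside_ball : mu [set z | (1 < `|z|)%R] = 1%E.

Lemma mu_norm_gt (t : R) : 0 < t -> mu [set z | (t < `|z|)%R] = (t `^ (- alpha))%:E.
Proof.
move=> t0; have := mu_superlevel 1 (@norm_continuous R V) homogeneous_norm t0.
by rewrite expr1 mulr1 mu_outside_ball mule1.
Qed.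

Lemma mu_sphere_null (t : R) : 0 < t -> mu [set z | (`|z| = t)%R] = 0%E.
Proof.
move=> t0; apply: (mu_level_null (@norm_continuous R V) homogeneous_norm) => //.
by rewrite mu_norm_gt// ltry.
Qed.

(** The set is open and its closure lies in {g >= c} `&` {|z| >= s}, so its boundary
    lies in the union of a level set of g and a sphere. *)
Lemma mu_boundary_null g p c (s : R) : continuous g -> homogeneous p g -> (0 < p)%N ->
  0 < c -> 0 < s -> (mu [set z | (c < g z)%R] < +oo)%E ->
  let A := [set z : V | c < g z /\ s < `|z|] in mu (closure A `\` interior A) = 0%E.
Proof.
move=> cg hg p0 c0 s0 fin A.
have cn := @norm_continuous R V.
have oA : open A.
  rewrite (_ : A = (g @^-1` [set x | c < x]) `&` ((fun z : V => `|z|) @^-1` [set x | s < x]))//.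
  apply: openI; [move/continuousP : cg|move/continuousP : cn]; by apply; exact: open_gt.
have cB : closed ((g @^-1` [set x | c <= x]) `&` ((fun z : V => `|z|) @^-1` [set x | s <= x])).
  apply: closedI; [move/continuous_closedP : cg|move/continuous_closedP : cn];
    by apply; exact: closed_ge.
have AB : closure A `<=`
    (g @^-1` [set x | c <= x]) `&` ((fun z : V => `|z|) @^-1` [set x | s <= x]).
  rewrite closureE => z; apply; split => //.
  by move=> y [] /ltW ? /ltW.
have m1 : measurable ([set z | g z = c] : set (borel_type V)).
  rewrite -[X in measurable X]setTI.
  exact: (continuous_borel_measurable cg measurableT (measurable_set1 c)).
have m2 : measurable ([set z : V | `|z| = s] : set (borel_type V)).
  rewrite -[X in measurable X]setTI.
  exact: (continuous_borel_measurable cn measurableT (measurable_set1 s)).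
apply/eqP; rewrite eq_le measure_ge0 andbT.
apply: (@le_trans _ _ (mu ([set z | g z = c] `|` [set z | `|z| = s]))).
  apply: le_measure; rewrite ?inE.
  - apply: measurableD; first by apply: closed_borel; exact: closed_closure.
    by apply: open_borel; exact: open_interior.
  - exact: measurableU.
  move=> z [/AB[/= gz nz]]; have := oA; rewrite interior_id => -> nA.
  move: gz; rewrite le_eqVlt => /orP[/eqP<-|gz]; first by left.
  move: nz; rewrite le_eqVlt => /orP[/eqP<-|nz]; first by right.
  by exfalso; apply: nA; split.
apply: le_trans (measureU2 _ _ _) _ => //.
rewrite -[leRHS]adde0; apply: leeD; rewrite le_eqVlt; apply/orP; left; apply/eqP.
  exact: (mu_level_null cg hg).
exact: mu_sphere_null.
Qed.

End homogeneous_measure.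

(** Turns the nondegeneracy of a marginal, which speaks of some Borel set C of the
    factor, into a statement about the norm of the component alone. *)
Lemma norm_gt0_charged (R : realType) (V W : normedModType R)
    (mu : {measure set (borel_type V) -> \bar R}) (f : V -> W) (C : set W) :
  continuous f -> measurable (C : set (borel_type W)) ->
  mu [set z | C (f z) /\ f z != 0] <> 0%E -> mu [set z | (0 < `|f z|)%R] <> 0%E.
Proof.
move=> cf mC muC mu0; apply: muC.
have cn : continuous (fun z => `|f z|) by move=> z; apply: cvg_norm; exact: cf.
have mpos := measurable_superlevel 0 cn.
apply/eqP; rewrite eq_le measure_ge0 andbT -mu0.
rewrite (_ : [set z | _ /\ _] = [set z | C (f z)] `&` [set z | 0 < `|f z|]).
  have mCf : measurable ([set z | C (f z)] : set (borel_type V)).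
    by have := continuous_borel_measurable_to cf measurableT mC; rewrite setTI.
  apply: le_measure; rewrite ?inE//; exact: measurableI.
by apply/seteqP; split => z /=; rewrite normr_gt0.
Qed.

(** * Regularly varying tails and second moments *)

Section tail_moment.
Context (R : realType).

Lemma geometric_sum_le (q : R) (n : nat) : 0 <= q < 1 ->
  \sum_(0 <= j < n) q ^+ j <= (1 - q)^-1.
Proof.
move=> /andP[q0 q1]; rewrite -[leRHS]mul1r ler_pdivlMr ?subr_gt0//.
suff -> : (\sum_(0 <= j < n) q ^+ j) * (1 - q) = 1 - q ^+ n.
  by rewrite gerBl exprn_ge0.
elim: n => [|n IH]; first by rewrite big_geq// mul0r expr0 subrr.
by rewrite big_nat_recr//= mulrDl IH exprS; ring.
Qed.

Lemma powR2_gt1 (p : R) : 0 < p -> 1 < 2 `^ p.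
Proof.
move=> p0; have := @gt0_ltr_powR R p p0 1 2.
by rewrite powR1 !nnegrE => -> //; rewrite ltr1n.
Qed.

Lemma powR2_lt1 (p : R) : 0 < p -> 2 `^ (- p) < 1.
Proof. by move=> p0; rewrite powRN invf_lt1 ?powR_gt0// powR2_gt1. Qed.

Lemma powR_exprn (x a : R) (j : nat) : 0 <= x -> (x ^+ j) `^ a = (x `^ a) ^+ j.
Proof. by move=> x0; rewrite -(powR_mulrn j x0) -(powR_mulrn j (powR_ge0 x a)) powRAC. Qed.

(** The one-sided bound that regular variation of index -alpha gives between
    consecutive dyadic scales, from the asymptotics along b alone.  For x large, let n
    be the integer part of 1 / F x.  Since n F (b n s) tends to s^-alpha > 1 when
    s < 1, F x <= 1/n forces b n s < x, hence F (2 x) <= F (b n (2 s)), which is about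
    (2 s)^-alpha / n, hence at most about (2 s)^-alpha F x because F x > 1/(n + 1).
    As alpha > 2, s can be chosen so close to 1 that (2 s)^-alpha < 1/4. *)
Lemma tail_halving (F : R -> R) (b : nat -> R) (alpha : R) :
  (forall x, 0 <= F x) -> (forall x y, x <= y -> F y <= F x) ->
  2 < alpha -> b n @[n --> \oo] --> +oo ->
  (forall t, 0 < t -> n%:R * F (b n * t) @[n --> \oo] --> t `^ (- alpha)) ->
  exists c x0 : R, [/\ 0 <= c, 4 * c < 1, 0 < x0 &
    forall x, x0 <= x -> F (2 * x) <= c * F x].
Proof.
move=> F0 Fdec a2 binf Fb.
(* The exponent (alpha + 2) / 2 lies strictly between 2 and alpha: q < 1/4 leaves room
   for the limit, and s below is the number < 1 with (2 s)^-alpha = q. *)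
pose q : R := 2 `^ (- ((alpha + 2) / 2)).
have q4 : 4 * q < 1.
  have -> : 4 = (2 : R) `^ 2.
    by rewrite powR_mulrn// -natrX.
  rewrite /q -powRD; last by apply/implyP => _; rewrite pnatr_eq0.
  rewrite (_ : _ + _ = - ((alpha - 2) / 2)); last by field.
  by apply: powR2_lt1; lra.
have q0 : 0 < q by rewrite powR_gt0.
pose s : R := 2 `^ ((alpha + 2) / (2 * alpha) - 1).
have s0 : 0 < s by rewrite powR_gt0.
have alpha0 : alpha != 0 by rewrite gt_eqF//; lra.
have s2 : (2 * s) `^ (- alpha) = q.
  have -> : 2 * s = 2 `^ ((alpha + 2) / (2 * alpha)).
    rewrite -{1}(powRr1 (ltW (ltr0Sn R 1))) /s -powRD; last by apply/implyP => _; rewrite pnatr_eq0.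
    by congr (_ `^ _); ring.
  rewrite -powRrM; congr (_ `^ _).
  by field.
have s1 : 1 < s `^ (- alpha).
  rewrite -powRrM (_ : _ * _ = (alpha - 2) / 2); last by field.
  by apply: powR2_gt1; lra.
pose c : R := (q + 4^-1) / 2.
have qc : q < c by rewrite /c; lra.
have c4 : 4 * c < 1 by rewrite /c; lra.
have near1 : \forall n \near \oo, 1 < n%:R * F (b n * s).
  exact: (cvgr_gt _ (Fb _ s0)).
have near2 : \forall n \near \oo, (n%:R + 1) * F (b n * (2 * s)) < c.
  have s20 : 0 < 2 * s by rewrite mulr_gt0.
  have h : (n%:R * F (b n * (2 * s))) * (1 + n%:R^-1) @[n --> \oo] --> q * (1 + 0).
    apply: cvgM; first by rewrite -s2; exact: Fb.
    apply: cvgD; first exact: cvg_cst.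
    apply/gtr0_cvgV0; last exact: cvgr_idn.
  by near=> n; rewrite ltr0n; near: n; exact: nbhs_infty_gt.
  rewrite addr0 mulr1 in h.
  near=> n.
  have -> : (n%:R + 1) * F (b n * (2 * s)) = (n%:R * F (b n * (2 * s))) * (1 + n%:R^-1).
    have n0 : n%:R != 0 :> R by rewrite pnatr_eq0 -lt0n; near: n; exact: nbhs_infty_gt.
    by field.
  by near: n; exact: (cvgr_lt _ h).
have [N _ HN] : \forall n \near \oo, 1 < n%:R * F (b n * s) /\ (n%:R + 1) * F (b n * (2 * s)) < c.
  by near do split.
have [x0 x00 Fx0] : exists2 x0, 0 < x0 & F x0 * N.+1%:R <= 1.
  have h := Fb 1 ltr01; rewrite powR1 in h.
  have h2 : \forall n \near \oo, n%:R * F (b n * 1) < 2 by apply: (cvgr_lt _ h); rewrite ltr1n.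
  have h3 : \forall n \near \oo, 0 < b n by exact: (cvgryPgt _).1.
  have [n [h4 h5 h6]] : exists n, [/\ n%:R * F (b n * 1) < 2, 0 < b n & (2 * N.+1 <= n)%N].
    near \oo => n; exists n; split.
    - by near: n.
    - by near: n.
    - by near: n; exact: nbhs_infty_ge.
  exists (b n) => //.
  rewrite mulr1 in h4.
  have : (2 * N.+1)%:R * F (b n) <= n%:R * F (b n) by rewrite ler_wpM2r// ler_nat.
  rewrite natrM => h7; nra.
exists c, x0; split => //; first by rewrite ltW// (lt_trans q0).
move=> x x0x.
have [Fx|Fx] := eqVneq (F x) 0.
  rewrite Fx mulr0 -Fx; apply: Fdec; lra.
have Fx0' : 0 < F x by rewrite lt_neqAle eq_sym Fx F0.
pose n := Num.truncn (F x)^-1.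
have /andP[n1 n2] : n%:R <= (F x)^-1 < n.+1%:R by apply: truncn_itv; rewrite invr_ge0.
have Nn : (N <= n)%N.
  rewrite -ltnS -(ltr_nat R); apply: le_lt_trans n2.
  rewrite -[leRHS]mul1r ler_pdivlMr//.
  have : F x <= F x0 by exact: Fdec.
  move: Fx0; rewrite -natr1 => Fx0 FF.
  have : 0 <= N%:R :> R by [].
  by nra.
have [h1 h2] := HN n Nn.
have Fn : n%:R * F x <= 1 by rewrite -ler_pdivlMr// mul1r.
have FF : F x < F (b n * s).
  rewrite -(@ltr_pM2l _ n%:R); first exact: le_lt_trans h1.
  rewrite lt_neqAle ler0n andbT eq_sym; apply/eqP => n0.
  by move: h1; rewrite n0 mul0r ltr10.
have bx : b n * s < x by rewrite ltNge; apply/negP => /Fdec; rewrite leNgt FF.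
have F2 : F (2 * x) <= F (b n * (2 * s)) by apply: Fdec; lra.
move: n2; rewrite -natr1 => n2.
have : 1 < (n%:R + 1) * F x by rewrite -ltr_pdivrMr// mul1r.
move=> h3.
have n10 : 0 < n%:R + 1 :> R by rewrite natr1 ltr0n.
rewrite -(@ler_pM2l _ (n%:R + 1))//.
apply: (@le_trans _ _ c); first by apply: le_trans (ltW h2); rewrite ler_pM2l.
have c0 : 0 < c by exact: lt_trans qc.
by rewrite mulrCA; rewrite ler_peMr// ltW.
Unshelve. all: by end_near. Qed.

End tail_moment.

Section truncated_second_moment.
Context (R : realType) (V : normedModType R).

(** The shell {2^j x < |z| <= 2^(j+1) x} contributes at most
    (2^(j+1) x)^2 c^j a = 4 x^2 a (4 c)^j. *)
Lemma second_moment_tail (kappa : {measure set (borel_type V) -> \bar R}) (x c a : R) :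
  0 < x -> 0 <= c -> 4 * c < 1 -> 0 <= a ->
  (forall j, kappa [set z | (2 ^+ j * x < `|z|)%R] <= (c ^+ j * a)%:E)%E ->
  (\int[kappa]_(z in [set z : V | (x < `|z|)%R]) (`|z| ^+ 2)%:E
     <= (4 * x ^+ 2 * a / (1 - 4 * c))%:E)%E.
Proof.
move=> x0 c0 c4 a0 kj.
pose F j := [set z : V | 2 ^+ j * x < `|z| <= 2 ^+ j.+1 * x].
have cn := continuous_borel_measurable (@norm_continuous R V).
have mF j : measurable (F j : set (borel_type V)).
  rewrite (_ : F j = setT `&` (fun z : V => `|z|) @^-1` `]2 ^+ j * x, 2 ^+ j.+1 * x]%classic).
    exact: (cn measurableT _ (measurable_itv _)).
  by rewrite setTI; apply/seteqP; split => z /=; rewrite in_itv.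
have mn2 : measurable_fun setT (fun z : borel_type V => (`|z : V| ^+ 2)%:E).
  by apply/measurable_EFinP; exact: measurable_funX.
have -> : [set z : V | x < `|z|] = \bigcup_j F j.
  apply/seteqP; split => z /=.
    move=> xz.
    have /= [n xn] : exists n, `|z| <= 2 ^+ n * x.
      pose n := Num.truncn (`|z| / x).
      exists n.+1; rewrite -ler_pdivrMr//.
      apply: (le_trans (ltW (truncnS_gt _))).
      by rewrite -natrX ler_nat ltnW// ltn_expl.
    have ex : exists n, (`|z| <= 2 ^+ n * x) by exists n.
    have := ex_minnP ex; case=> -[|m] zm mmin.
      by move: xz; rewrite ltNge; move: zm; rewrite expr0 mul1r => ->.
    exists m => //; rewrite /F/= zm andbT ltNge; apply/negP => /mmin.
    by rewrite ltnn.
  move=> [j _ /andP[+ _]]; apply: le_lt_trans.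
  by apply: ler_peMl; [exact: ltW|rewrite exprn_ege1// ler1n].
rewrite ge0_integral_bigcup//; last 2 first.
- exact: measurable_funTS.
- move=> i j _ _ [z [/= /andP[z1 z2] /andP[z3 z4]]].
  have h m n : 2 ^+ m * x < `|z| -> `|z| <= 2 ^+ n.+1 * x -> (m <= n)%N.
    move=> u v; have := lt_le_trans u v; rewrite ltr_pM2r// ltr_eXn2l ?ltr1n//.
  by apply/eqP; rewrite eqn_leq (h i j) ?(h j i).
apply: lime_le.
  apply: is_cvg_nneseries => n _ _; apply: integral_ge0 => z _.
  by rewrite lee_fin sqr_ge0.
near=> n.
apply: (@le_trans _ _ (\sum_(0 <= j < n) (4 * x ^+ 2 * a * (4 * c) ^+ j)%:E)%E).
  apply: lee_sum => j _.
  apply: (@le_trans _ _ (\int[kappa]_(z in F j) ((2 ^+ j.+1 * x) ^+ 2)%:E)%E).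
    apply: ge0_le_integral => //.
    - exact: measurable_funTS.
    - move=> z /= /andP[_ zj]; rewrite lee_fin lerXn2r ?nnegrE//.
      exact: le_trans zj.
  rewrite integral_cst//.
  apply: (@le_trans _ _ (((2 ^+ j.+1 * x) ^+ 2)%:E * (c ^+ j * a)%:E)%E).
    apply: lee_pmul => //; first by rewrite lee_fin sqr_ge0.
    apply: le_trans (kj j); apply: le_measure; rewrite ?inE//.
      exact: measurable_gtr.
    by move=> z /= /andP[].
  rewrite -EFinM lee_fin (exprS 2) [(4 * c) ^+ j]exprMn.
  have -> : 4 ^+ j = (2 ^+ j) ^+ 2 :> R.
    by rewrite -exprM mulnC exprM; congr (_ ^+ _); ring.
  by rewrite le_eqVlt; apply/orP; left; apply/eqP; ring.
rewrite sumEFin lee_fin -mulr_sumr ler_wpM2l//.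
  by rewrite mulr_ge0// mulr_ge0// sqr_ge0.
by apply: geometric_sum_le; rewrite c4 andbT mulr_ge0.
Unshelve. all: by end_near. Qed.

End truncated_second_moment.

(** * Events of small probability *)

Section high_probability.
Context d (Omega : measurableType d) (R : realType) (P : probability Omega R).

(** The property may fail only inside a measurable event of small probability.  The
    event is quantified, so Q itself need not be measurable. *)
Definition whp (Q : nat -> Omega -> Prop) := forall eta : R, 0 < eta ->
  \forall n \near \oo, exists B, [/\ measurable B, (P B <= eta%:E)%E &
    forall w, ~ B w -> Q n w].

Lemma whp_and (Q1 Q2 : nat -> Omega -> Prop) : whp Q1 -> whp Q2 ->
  whp (fun n w => Q1 n w /\ Q2 n w).
Proof.
move=> h1 h2 eta eta0; have eta2 : 0 < eta / 2 by rewrite divr_gt0.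
near=> n.
have [B1 [mB1 P1 H1]] : exists B, [/\ measurable B, (P B <= (eta / 2)%:E)%E &
    forall w, ~ B w -> Q1 n w] by near: n; exact: h1.
have [B2 [mB2 P2 H2]] : exists B, [/\ measurable B, (P B <= (eta / 2)%:E)%E &
    forall w, ~ B w -> Q2 n w] by near: n; exact: h2.
exists (B1 `|` B2); split; first exact: measurableU.
  rewrite [eta]splitr EFinD; apply: (le_trans (measureU2 _ mB1 mB2)).
  exact: leeD.
by move=> w /not_orP[w1 w2]; split; [exact: H1|exact: H2].
Unshelve. all: by end_near. Qed.

Lemma whp_sub (Q1 Q2 : nat -> Omega -> Prop) : whp Q1 ->
  (\forall n \near \oo, forall w, Q1 n w -> Q2 n w) -> whp Q2.
Proof.
move=> h1 h12 eta eta0; near=> n.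
have [B [mB PB HB]] : exists B, [/\ measurable B, (P B <= eta%:E)%E &
    forall w, ~ B w -> Q1 n w] by near: n; exact: h1.
exists B; split => // w /HB; move: w.
by near: n.
Unshelve. all: by end_near. Qed.

Lemma whp_cvg_in_probability (f : nat -> Omega -> R) (c : R) :
  (\forall n \near \oo, measurable_fun setT (f n)) ->
  (forall e, 0 < e -> whp (fun n w => `|f n w - c| <= e)) ->
  cvg_in_probability P f c.
Proof.
move=> mf h e e0.
have key eta : 0 < eta -> \forall n \near \oo, (P [set w | (e < `|f n w - c|)%R] <= eta%:E)%E.
  move=> eta0; near=> n.
  have mfn : measurable_fun setT (f n) by near: n.
  have [B [mB PB HB]] : exists B, [/\ measurable B, (P B <= eta%:E)%E &
    forall w, ~ B w -> `|f n w - c| <= e] by near: n; exact: h.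
  apply: le_trans PB; apply: le_measure; rewrite ?inE//.
    apply: measurable_gtr; apply: measurableT_comp => //.
    exact: measurable_funB.
  by move=> w /= ew; apply: contrapT => /HB; rewrite leNgt ew.
apply/fine_cvgP; split.
  apply: filterS (key 1 ltr01) => n h1; rewrite ge0_fin_numE//.
  exact: le_lt_trans h1 (ltry _).
apply/cvgr0Pnorm_le => eta eta0; apply: filterS (key _ eta0) => n hn /=.
rewrite ger0_norm ?fine_ge0// -lee_fin fineK// ge0_fin_numE//.
by apply: le_lt_trans hn (ltry _).
Unshelve. all: by end_near. Qed.

End high_probability.

(** * Layer cake sums *)

Section layer_cake.
Context (R : realType).

(** The sum rounds x down to a multiple of eps, strictly below x when x > 0, and is
    capped at J eps. *)
Lemma layer_cake_sum (eps x : R) (J : nat) : 0 < eps -> 0 <= x ->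
  let S := \sum_(0 <= j < J) eps * (j.+1%:R * eps < x)%R%:R in
  S <= x /\ (x <= J.+1%:R * eps -> x <= S + eps).
Proof.
move=> eps0 x0; elim: J => [|J IH] /=.
  by rewrite big_geq// add0r mul1r.
move: IH => /=; rewrite big_nat_recr//=; set S := \sum_(_ <= _ < _) _ => -[S1 S2].
have SJ : S <= J%:R * eps.
  rewrite /S mulr_natl -[J in leRHS]subn0 -sumr_const_nat; apply: ler_sum => j _.
  by rewrite ger_pMr//; case: (_ < _).
have h1 : J.+1%:R * eps = J%:R * eps + eps by rewrite -natr1 mulrDl mul1r.
have h2 : J.+2%:R * eps = J%:R * eps + eps + eps by rewrite -natr1 mulrDl mul1r h1.
case: ltP => Jx; rewrite ?mulr1 ?mulr0 ?addr0; last by split => // _; exact: S2.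
split; first by lra.
move=> xJ; have [xJ1|xJ1] := ltP (J%:R * eps) S; first by lra.
suff : J%:R * eps <= S by lra.
rewrite /S mulr_natl -[J in leLHS]subn0 -sumr_const_nat.
rewrite !big_nat; apply: ler_sum => j /andP[_ jJ].
rewrite (_ : _ < _) ?mulr1//; apply: lt_trans Jx.
by rewrite ltr_pM2r// ltr_nat.
Qed.

Lemma integral_mul_indic d (T : measurableType d) (kappa : {measure set T -> \bar R})
    (f : T -> R) (D : set T) :
  (\int[kappa]_z (f z * \1_D z)%:E = \int[kappa]_(z in D) (f z)%:E)%E.
Proof. by rewrite [RHS]integral_mkcond epatch_indic; apply: eq_integral => z _ /=; rewrite EFinM. Qed.

End layer_cake.

(** * Order statistics *)

Section order_statistic.
Context (R : realType).

(** In a nonincreasing list the entries above t form an initial segment. *)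
Lemma sorted_nth_gt (s : seq R) (t : R) (j : nat) : sorted >=%R s -> (j < size s)%N ->
  (t < nth 0 s j) = (j < count (fun x => (t < x)%R) s)%N.
Proof.
elim: s j => [|x s IH] j //= xs js.
have tr : transitive (>=%R : rel R) by move=> y u v uy yv; exact: le_trans yv uy.
have [tx|xt] := ltP t x.
  case: j js => [|j] js //=.
  by rewrite IH// (path_sorted xs).
have all_le : all (fun y => y <= x) s by exact: (order_path_min tr xs).
have -> : count (fun y => (t < y)%R) s = 0%N.
  apply/eqP; rewrite -leqn0 leqNgt -has_count; apply/negP => /hasP[y ys ty].
  by have := le_lt_trans (le_trans (allP all_le _ ys) xt) ty; rewrite ltxx.
case: j js => [|j] js /=; first by rewrite ltNge xt.
by rewrite ltNge (le_trans _ xt)//; apply: (allP all_le); exact: mem_nth.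
Qed.

Lemma lt_kth_largest (k : nat) (s : seq R) (t : R) : (0 < k <= size s)%N ->
  (t < kth_largest k s) = (k <= count (fun x => (t < x)%R) s)%N.
Proof.
move=> /andP[k0 ks]; rewrite /kth_largest sorted_nth_gt ?size_sort ?prednK//.
  by rewrite (permP (permEl (perm_sort _ _))).
by apply: sort_sorted => x y; exact: le_total.
Qed.

Lemma invD1_bounds (u : R) : 0 < u -> u <= 1 -> 1 - u <= (1 + u)^-1 <= 1 - u / 2.
Proof.
move=> u0 u1; have up : 0 < 1 + u by rewrite addr_gt0.
have uu : 0 <= u * (1 - u) by rewrite mulr_ge0 ?subr_ge0// ltW.
rewrite -[X in _ <= X <= _]mul1r ler_pdivlMr// ler_pdivrMr//.
by apply/andP; split; nra.
Qed.

(** A and B stand for the numbers of observations above the two thresholds, divided by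
    k: they are on either side of 1 and differ by at most 3 u, and t^2 <= 4. *)
Lemma threshold_counts (u e A B t : R) : 0 < u -> u <= 1 -> u <= e / 24 ->
  0 < t -> t <= 1 + u -> `|A - (1 + u)| <= u / 4 -> `|B - (1 + u)^-1| <= u / 4 ->
  [/\ 1 <= A, B < 1 & 0 <= A - B -> t ^+ 2 * (A - B) <= e / 2].
Proof.
move=> u0 u1 ue t0 tu; rewrite !ler_norml => /andP[a1 a2] /andP[b1 b2].
have /andP[inv1 inv2] := invD1_bounds u0 u1.
split; [lra|lra|move=> AB].
have t4 : t ^+ 2 <= 4.
  have -> : 4 = 2 ^+ 2 :> R by ring.
  by rewrite lerXn2r ?nnegrE// ?(ltW t0)//; lra.
apply: (@le_trans _ _ (4 * (3 * u))); last by lra.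
by apply: ler_pM => //; [exact: sqr_ge0|lra].
Qed.

End order_statistic.

(** * Intermediate sequences and tail means *)

Section intermediate_sequence.
Context (R : realType) (k : nat -> nat).
Hypothesis k_infty : k n @[n --> \oo] --> \oo.
Hypothesis k_small : (k n)%:R / n%:R @[n --> \oo] --> (0 : R).

Lemma k_gt0 : \forall n \near \oo, (0 < k n)%N.
Proof. by move/cvgnyPgt : k_infty; apply. Qed.

Lemma k_leS (N : nat) : \forall n \near \oo, (k n * N <= n)%N.
Proof.
have h : \forall n \near \oo, (k n)%:R / n%:R < (N.+1%:R)^-1 :> R.
  by apply: (cvgr_lt _ k_small); rewrite invr_gt0.
near=> n.
have n0 : (0 < n)%N by near: n; exact: nbhs_infty_gt.
have : (k n)%:R / n%:R < (N.+1%:R)^-1 :> R by near: n.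
rewrite ltr_pdivrMr ?ltr0n// mulrC ltr_pdivlMr ?ltr0n// -natrM ltr_nat => /ltnW.
by apply: leq_trans; rewrite leq_mul2l leqnSn orbT.
Unshelve. all: by end_near. Qed.

Lemma k_le : \forall n \near \oo, (k n <= n)%N.
Proof. by apply: filterS (k_leS 1) => n; rewrite muln1. Qed.

Lemma divn_k_infty : (n %/ k n)%N @[n --> \oo] --> \oo.
Proof.
apply/cvgnyPge => N; near=> n.
rewrite leq_divRL; last by near: n; exact: k_gt0.
by rewrite mulnC; near: n; exact: k_leS.
Unshelve. all: by end_near. Qed.

(** Passes from the integers n %/ k n, along which regular variation is known, to the
    ratio n / k n: with m = n %/ k n one has m <= n / k <= m + 1. *)
Lemma scaled_mean_cvg (u : nat -> R) (L : R) : (forall m, 0 <= u m) ->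
  m%:R * u m @[m --> \oo] --> L ->
  n%:R / (k n)%:R * u (n %/ k n)%N @[n --> \oo] --> L.
Proof.
move=> u0 uL.
have h1 : (n %/ k n)%N%:R * u (n %/ k n)%N @[n --> \oo] --> L.
  exact: (cvg_comp _ _ divn_k_infty uL).
have h2 : ((n %/ k n)%N%:R * u (n %/ k n)%N) * (1 + ((n %/ k n)%N%:R)^-1) @[n --> \oo] --> L * (1 + 0).
  apply: cvgM => //; apply: cvgD; first exact: cvg_cst.
  apply/gtr0_cvgV0; last by apply/cvgrnyP; exact: divn_k_infty.
  near=> n; rewrite ltr0n; near: n.
  by move/cvgnyPgt : divn_k_infty; apply.
rewrite addr0 mulr1 in h2.
apply: (squeeze_cvgr _ h1 h2); near=> n.
have k0 : (0 < k n)%N by near: n; exact: k_gt0.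
have m0 : (0 < n %/ k n)%N by near: n; move/cvgnyPgt : divn_k_infty; apply.
have kR : 0 < (k n)%:R :> R by rewrite ltr0n.
apply/andP; split.
  by rewrite ler_wpM2r// ler_pdivlMr// -natrM ler_nat leq_trunc_div.
rewrite [leRHS]mulrAC ler_wpM2r//.
rewrite mulrDr mulr1 divff ?pnatr_eq0 -?lt0n// ler_pdivrMr// natr1 -natrM ler_nat.
by rewrite ltnW// ltn_ceil.
Unshelve. all: by end_near. Qed.

End intermediate_sequence.

Section tail_empirical.
Context d (Omega : measurableType d) (R : realType) (P : probability Omega R).
Context (V : normedModType R).
Variables (Z : Omega -> V) (Z_ : nat -> Omega -> V) (alpha : R) (b : nat -> R).
Variables (mu : {measure set (borel_type V) -> \bar R}) (k : nat -> nat).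
Hypothesis mZ : measurable_fun setT (Z : Omega -> borel_type V).
Hypothesis alpha_gt2 : 2 < alpha.
Hypothesis Z_rv : regularly_varying P Z alpha b mu.
Hypothesis mu_outside_ball : mu [set z | (1 < `|z|)%R] = 1%E.
Hypothesis Z_copies :
  independent_copies P (Z_ : nat -> Omega -> borel_type V) (Z : Omega -> borel_type V).
Hypothesis k_infty : k n @[n --> \oo] --> \oo.
Hypothesis k_small : (k n)%:R / n%:R @[n --> \oo] --> (0 : R).

Let alpha_gt0 : 0 < alpha. Proof. by rewrite (lt_trans _ alpha_gt2). Qed.

Let mu_homogeneous (t : R) (A : set (borel_type V)) : 0 < t -> measurable A ->
  mu [set t *: (z : V) | z in A] = ((t `^ (- alpha))%:E * mu A)%E.
Proof. by case: Z_rv => _ _ _ + _; exact. Qed.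

Let mu_norm t (t0 : 0 < t) := mu_norm_gt mu_homogeneous mu_outside_ball t0.

(** A scale exceeded in norm by about k of the n observations, since about one in
    n %/ k n exceeds it. *)
Definition tail_scale n := b (n %/ k n)%N.

Lemma tail_scale_infty : tail_scale n @[n --> \oo] --> +oo.
Proof. by case: Z_rv => _ binf _ _ _; exact: (cvg_comp _ _ (divn_k_infty k_infty k_small) binf). Qed.

Lemma tail_scale_gt0 : \forall n \near \oo, 0 < tail_scale n.
Proof. by have /cvgryPgt := tail_scale_infty; apply. Qed.

Definition tail_mean (f : V -> R) n w :=
  (\sum_(0 <= i < n) f ((tail_scale n)^-1 *: Z_ i w)) / (k n)%:R.

Lemma measurable_scaled (X : Omega -> V) (a : R) (A : set (borel_type V)) :
  measurable_fun setT (X : Omega -> borel_type V) -> measurable A ->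
  measurable [set w | A (a *: X w)].
Proof.
move=> mX mA; rewrite -[X in measurable X]setTI.
have := measurableT_comp (@scale_borel_measurable R V a) mX.
exact.
Qed.

Lemma prob_copy i a (A : set (borel_type V)) : measurable A ->
  P [set w | A (a *: Z_ i w)] = P [set w | A (a *: Z w)].
Proof.
move=> mA; case: Z_copies => _ + _.
move=> /(_ i [set z : V | A (a *: z)]); apply.
by have := scale_borel_measurable a measurableT mA; rewrite setTI.
Qed.

Lemma prob_copies2 i j a (A : set (borel_type V)) : measurable A -> i != j ->
  P ([set w | A (a *: Z_ i w)] `&` [set w | A (a *: Z_ j w)]) =
  (P [set w | A (a *: Z w)] * P [set w | A (a *: Z w)])%E.
Proof.
move=> mA ij; case: Z_copies => _ _ /(_ [:: i; j] (fun=> [set z : V | A (a *: z)])).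
rewrite /= inE ij => /(_ isT).
have mB : measurable ([set z : V | A (a *: z)] : set (borel_type V)).
  by have := scale_borel_measurable a measurableT mA; rewrite setTI.
move=> /(_ (fun=> mB)); rewrite big_cons big_seq1.
rewrite -{1}(prob_copy i a mA) -(prob_copy j a mA) => <-; congr (P _).
by rewrite bigcap_seq big_cons big_seq1.
Qed.

(** The mean of the tail mean is n / k times the probability of A at the current
    scale, and its variance is of order 1 / k. *)
Lemma tail_mean_indic (A : set V) : measurable (A : set (borel_type V)) ->
  bounded_away A -> mu (closure A `\` interior A) = 0%E ->
  forall e, 0 < e -> whp P (fun n w => `|tail_mean \1_A n w - fine (mu A)| <= e).
Proof.
move=> mA bA dA e e0.
have muA : (mu A < +oo)%E by case: Z_rv => _ _ [_ +] _ _; apply.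
pose p m := fine (P [set w | A ((b m)^-1 *: Z w)]).
have p_fin m : P [set w | A ((b m)^-1 *: Z w)] = (p m)%:E.
  by rewrite fineK// fin_num_measure//; exact: measurable_scaled.
have p0 m : 0 <= p m by rewrite fine_ge0.
have pL : m%:R * p m @[m --> \oo] --> fine (mu A).
  case: Z_rv => _ _ _ _ /(_ A mA bA dA).
  rewrite -{1}(@fineK _ (mu A)) ?ge0_fin_numE// => /fine_cvgP[_].
  by apply: cvg_trans; apply: near_eq_cvg; near=> m; rewrite /= p_fin.
have qL := scaled_mean_cvg k_infty k_small p0 pL.
pose q n := n%:R / (k n)%:R * p (n %/ k n)%N.
move=> eta eta0; near=> n.
have k0 : 0 < (k n)%:R :> R by rewrite ltr0n; near: n; exact: k_gt0.
have q1 : q n < fine (mu A) + 1.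
  by near: n; apply: (cvgr_lt _ qL); rewrite ltrDl.
have q2 : `|fine (mu A) - q n| <= e / 2.
  by near: n; move/cvgrPdist_le : qL; apply; rewrite divr_gt0.
pose E i := [set w | A ((tail_scale n)^-1 *: Z_ i w)].
have mE i : measurable (E i) by apply: measurable_scaled => //; case: Z_copies.
have PE i : P (E i) = (p (n %/ k n)%N)%:E by rewrite prob_copy// p_fin.
have PEE i j : i != j -> P (E i `&` E j) = (p (n %/ k n)%N ^+ 2)%:E.
  by move=> ij; rewrite prob_copies2// p_fin -EFinM expr2.
have ek : 0 < e / 2 * (k n)%:R by rewrite mulr_gt0// divr_gt0.
have := count_concentration n mE PE PEE ek.
set B := [set w | _] => PB; exists B; split.
- apply: measurable_gtr; apply: measurableT_comp => //; apply: measurable_funB => //.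
  by apply: measurable_sum => i; exact: measurable_indic.
- apply: le_trans PB _; rewrite lee_fin.
  have -> : n%:R * p (n %/ k n)%N / (e / 2 * (k n)%:R) ^+ 2 = q n / ((e / 2) ^+ 2 * (k n)%:R).
    by rewrite /q; field; rewrite !gt_eqF.
  rewrite ler_pdivrMr ?mulr_gt0 ?exprn_gt0 ?divr_gt0// mulrA.
  apply: (le_trans (ltW q1)).
  rewrite -ler_pdivrMl; last by rewrite mulr_gt0 ?exprn_gt0 ?divr_gt0.
  by near: n; have /(cvgrnyP (R := R))/cvgryPge := k_infty; apply.
- move=> w /negP; rewrite /B/= -leNgt => wB.
  have -> : tail_mean \1_A n w - fine (mu A) =
     (\sum_(0 <= i < n) \1_(E i) w - n%:R * p (n %/ k n)%N) / (k n)%:R + - (fine (mu A) - q n).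
    by rewrite mulrBl opprB /q [n%:R / _ * _]mulrAC addrA subrK.
  apply: (le_trans (ler_normD _ _)); rewrite normrN [e]splitr lerD//.
  by rewrite normrM normfV (ger0_norm (ltW k0)) ler_pdivrMr.
Unshelve. all: by end_near. Qed.

Lemma measurable_scaling (X : Omega -> V) (a : R) :
  measurable_fun setT (X : Omega -> borel_type V) ->
  measurable_fun setT ((fun w => a *: X w) : Omega -> borel_type V).
Proof. by move=> mX; exact: measurableT_comp (@scale_borel_measurable R V a) mX. Qed.

Definition scaled_rv (n : nat) : {mfun Omega >-> borel_type V} :=
  HB.pack ((fun w => (tail_scale n)^-1 *: Z w) : Omega -> borel_type V)
    (isMeasurableFun.Build _ _ _ _ _ (measurable_scaling (tail_scale n)^-1 mZ)).

Definition scaled_copy (mZ_ : forall i, measurable_fun setT (Z_ i : Omega -> borel_type V))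
    (n i : nat) : {mfun Omega >-> borel_type V} :=
  HB.pack ((fun w => (tail_scale n)^-1 *: Z_ i w) : Omega -> borel_type V)
    (isMeasurableFun.Build _ _ _ _ _ (measurable_scaling (tail_scale n)^-1 (mZ_ i))).

Definition scaled_law n : probability (borel_type V) R := distribution P (scaled_rv n).

(** Each copy has the law of Z, so the n terms have equal expectations. *)
Lemma expectation_tail_mean n (f : V -> R) :
  measurable_fun setT (f : borel_type V -> R) -> (forall z, 0 <= f z) ->
  (\int[P]_w (tail_mean f n w)%:E = (n%:R / (k n)%:R)%:E * \int[scaled_law n]_z (f z)%:E)%E.
Proof.
move=> mf f0.
have mZ_ : forall i, measurable_fun setT (Z_ i : Omega -> borel_type V) by case: Z_copies.
have mfZ i : measurable_fun setT (fun w => f ((tail_scale n)^-1 *: Z_ i w)).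
  exact: measurableT_comp mf (measurable_scaling _ (mZ_ i)).
have E i : (\int[P]_w (f ((tail_scale n)^-1 *: Z_ i w))%:E = \int[scaled_law n]_z (f z)%:E)%E.
  have H := @ge0_integral_distribution _ _ _ _ _ P (scaled_copy mZ_ n i) (EFin \o f).
  transitivity (\int[distribution P (scaled_copy mZ_ n i)]_z (f z)%:E)%E.
    by rewrite H//; exact/measurable_EFinP.
  apply: eq_measure_integral => A mA _.
  exact: (prob_copy i (tail_scale n)^-1 mA).
under eq_integral do rewrite /tail_mean mulrC EFinM.
rewrite ge0_integralZl_EFin//; last 2 first.
- by move=> w _; rewrite lee_fin sumr_ge0.
- by apply/measurable_EFinP; apply: measurable_sum => i; exact: mfZ.
rewrite ge0_integral_real_sum//.
rewrite (eq_bigr (fun=> \int[scaled_law n]_z (f z)%:E)%E) => [|i _]; last exact: E.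
set x := integral _ _ _.
have x0 : (0 <= x)%E by apply: integral_ge0 => z _; rewrite lee_fin.
have -> : (\sum_(0 <= i < n) x = n%:R%:E * x)%E.
  elim: (n) => [|m IH]; first by rewrite big_geq// mul0e.
  by rewrite big_nat_recr//= IH -[in RHS]natr1 EFinD ge0_muleDl ?lee_fin// mul1e.
by rewrite muleA -EFinM [(_^-1 * _)%R]mulrC.
Qed.

(** * Uniform smallness of second moments far out *)

Definition survival x := fine (P [set w | x < `|Z w|]).

Lemma measurable_survival x : measurable [set w | x < `|Z w|].
Proof.
rewrite -[X in measurable X]setTI.
by have := mZ measurableT (measurable_superlevel x (@norm_continuous R V)).
Qed.

Lemma survivalE x : P [set w | (x < `|Z w|)%R] = (survival x)%:E.
Proof. by rewrite fineK// fin_num_measure//; exact: measurable_survival. Qed.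

Lemma survival_ge0 x : 0 <= survival x. Proof. by rewrite fine_ge0. Qed.

Lemma survival_le x y : x <= y -> survival y <= survival x.
Proof.
move=> xy; rewrite -lee_fin -!survivalE; apply: le_measure; rewrite ?inE;
  try exact: measurable_survival.
by move=> w /=; exact: le_lt_trans.
Qed.

Lemma scaled_norm_gt (s t : R) (z : V) : 0 < s -> (t < `|s^-1 *: z|) = (s * t < `|z|).
Proof.
by move=> s0; rewrite normrZ normfV gtr0_norm// mulrC ltr_pdivlMr// mulrC.
Qed.

Lemma bounded_away_norm t : 0 < t -> bounded_away [set z : V | t < `|z|].
Proof.
by move=> t0; exists t => //; apply/seteqP; split => z //= -[/lt_trans h /h]; rewrite ltxx.
Qed.

Lemma tail_boundary_null t : 0 < t ->
  mu (closure [set z : V | t < `|z|] `\` interior [set z : V | t < `|z|]) = 0%E.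
Proof.
move=> t0; have /= := mu_boundary_null alpha_gt0 mu_homogeneous mu_outside_ball
  (@norm_continuous R V) (@homogeneous_norm R V) (leqnn 1) t0 t0.
rewrite (_ : [set z : V | _ /\ _] = [set z : V | t < `|z|]); last first.
  by apply/seteqP; split => z //= [].
by apply; rewrite mu_norm// ltry.
Qed.

Lemma survival_cvg t : 0 < t -> m%:R * survival (b m * t) @[m --> \oo] --> t `^ (- alpha).
Proof.
move=> t0; case: Z_rv => _ binf _ _.
move=> /(_ _ (measurable_superlevel t (@norm_continuous R V))
  (bounded_away_norm t0) (tail_boundary_null t0)).
rewrite mu_norm// => /fine_cvgP[_].
apply: cvg_trans; apply: near_eq_cvg; near=> m.
have b0 : 0 < b m by near: m; move/cvgryPgt : binf; apply.
rewrite /= [X in P X](_ : _ = [set w | b m * t < `|Z w|]) ?survivalE//.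
by apply/seteqP; split => w; rewrite /= scaled_norm_gt.
Unshelve. all: by end_near. Qed.

Lemma scaled_survival_cvg t : 0 < t ->
  n%:R / (k n)%:R * survival (tail_scale n * t) @[n --> \oo] --> t `^ (- alpha).
Proof.
move=> t0.
apply: (scaled_mean_cvg k_infty k_small (u := fun m => survival (b m * t))) => //.
  by move=> m; exact: survival_ge0.
exact: survival_cvg.
Qed.

Lemma scaled_law_norm n t : 0 < tail_scale n ->
  scaled_law n [set z | (t < `|z|)%R] = (survival (tail_scale n * t))%:E.
Proof.
move=> s0; rewrite -survivalE; congr (P _).
by apply/seteqP; split => w; rewrite /= scaled_norm_gt.
Qed.

(** By the dyadic bound both integrals are at most a constant times
    M^2 M^-alpha, which tends to 0 because alpha > 2.  For the sample, one application
    of the tail asymptotics at level M controls all the shells beyond it. *)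
Lemma tail_second_moment_small (theta : R) : 0 < theta -> exists M : R, [/\ 1 <= M,
  (\int[mu]_(z in [set z : V | (M < `|z|)%R]) (`|z| ^+ 2)%:E <= theta%:E)%E &
  \forall n \near \oo, ((n%:R / (k n)%:R)%:E *
    \int[scaled_law n]_(z in [set z : V | (M < `|z|)%R]) (`|z| ^+ 2)%:E <= theta%:E)%E].
Proof.
move=> theta0.
have binf : b n @[n --> \oo] --> +oo by case: Z_rv.
have [c [x0 [c0 c4 x00 cF]]] :=
  tail_halving survival_ge0 survival_le alpha_gt2 binf survival_cvg.
have q4 : 4 * 2 `^ (- alpha) < 1.
  have -> : 4 = (2 : R) `^ 2 by rewrite powR_mulrn// -natrX.
  rewrite -powRD; last by apply/implyP => _; rewrite pnatr_eq0.
  rewrite (_ : _ + _ = - (alpha - 2)); last by ring.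
  by apply: powR2_lt1; rewrite subr_gt0.
pose C := 8 / (1 - 4 * c) + 4 / (1 - 4 * 2 `^ (- alpha)).
have C1 : 0 < 8 / (1 - 4 * c) by rewrite divr_gt0// subr_gt0.
have C2 : 0 < 4 / (1 - 4 * 2 `^ (- alpha)) by rewrite divr_gt0// subr_gt0.
have C0 : 0 < C by rewrite addr_gt0.
(* Chosen so that M^(2 - alpha) = 1 / (1 + C / theta). *)
pose M := (1 + C / theta) `^ (alpha - 2)^-1.
have a2 : 0 < alpha - 2 by rewrite subr_gt0.
have CT : 0 < C / theta by rewrite divr_gt0.
have M1 : 1 <= M.
  have := @ge0_ler_powR R (alpha - 2)^-1; rewrite invr_ge0 => /(_ (ltW a2) 1 (1 + C / theta)).
  by rewrite powR1 !nnegrE; apply => //; lra.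
have M0 : 0 < M by lra.
have CM : C * (M ^+ 2 * M `^ (- alpha)) <= theta.
  have -> : M ^+ 2 * M `^ (- alpha) = (1 + C / theta)^-1.
    rewrite -powR_mulrn ?ltW// -powRD; last by apply/implyP => _; rewrite gt_eqF.
    rewrite -powRrM -[RHS]powR_inv1; last by lra.
    by congr (_ `^ _); field; lra.
  rewrite ler_pdivrMr; last by lra.
  by rewrite mulrDr mulr1 mulrC divfK ?gt_eqF// lerDr ltW.
have MM0 : 0 < M ^+ 2 * M `^ (- alpha) by apply: mulr_gt0; [exact: exprn_gt0|exact: powR_gt0].
exists M; split => //.
  have := @second_moment_tail R V mu M (2 `^ (- alpha)) (M `^ (- alpha)) M0
    (powR_ge0 _ _) q4 (powR_ge0 _ _).
  set I := integral _ _ _ => H.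
  apply: (@le_trans _ _ (4 * M ^+ 2 * M `^ (- alpha) / (1 - 4 * 2 `^ (- alpha)))%:E).
    apply: H => j; rewrite mu_norm; last by rewrite mulr_gt0 ?exprn_gt0.
    rewrite lee_fin powRM; [|by rewrite exprn_ge0|exact: ltW].
    by rewrite powR_exprn.
  rewrite lee_fin; apply: le_trans CM.
  rewrite (_ : _ / _ = 4 / (1 - 4 * 2 `^ (- alpha)) * (M ^+ 2 * M `^ (- alpha))).
    by rewrite ler_pM2r// lerDr ltW.
  ring.
near=> n.
have s0 : 0 < tail_scale n by near: n; exact: tail_scale_gt0.
have sx : x0 <= tail_scale n.
  by near: n; have /cvgryPge := tail_scale_infty; apply.
have qn : n%:R / (k n)%:R * survival (tail_scale n * M) < 2 * M `^ (- alpha).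
  near: n; apply: (cvgr_lt _ (scaled_survival_cvg M0)).
  by rewrite mulr2n mulrDl mul1r ltrDl powR_gt0.
have := @second_moment_tail R V (scaled_law n) M c (survival (tail_scale n * M)) M0 c0 c4 (survival_ge0 _).
set I := integral _ _ _ => H.
have {}H : (I <= (4 * M ^+ 2 * survival (tail_scale n * M) / (1 - 4 * c))%:E)%E.
  apply: H => j.
  apply: (@le_trans _ _ (survival (tail_scale n * (2 ^+ j * M)))%:E).
    by rewrite -scaled_law_norm.
  rewrite lee_fin.
  elim: j => [|j IH]; first by rewrite !expr0 !mul1r.
  rewrite exprS (_ : tail_scale n * _ = 2 * (tail_scale n * (2 ^+ j * M))); last by ring.
  apply: (le_trans (cF _ _)).
    apply: (le_trans sx); apply: ler_peMr; first exact: ltW.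
    apply: (le_trans M1); apply: ler_peMl; first exact: ltW.
    by rewrite exprn_ege1// ler1n.
  by rewrite [c ^+ _]exprS -mulrA ler_wpM2l.
apply: (@le_trans _ _ ((n%:R / (k n)%:R)%:E * (4 * M ^+ 2 * survival (tail_scale n * M) / (1 - 4 * c))%:E)%E).
  by rewrite lee_wpmul2l// lee_fin.
rewrite -EFinM lee_fin; apply: le_trans CM.
apply: (@le_trans _ _ (8 / (1 - 4 * c) * (M ^+ 2 * M `^ (- alpha)))); last first.
  by rewrite ler_pM2r// lerDl ltW.
rewrite [leLHS](_ : _ = 4 / (1 - 4 * c) * M ^+ 2 * (n%:R / (k n)%:R * survival (tail_scale n * M))); last by ring.
apply: (@le_trans _ _ (4 / (1 - 4 * c) * M ^+ 2 * (2 * M `^ (- alpha)))).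
  apply: ler_wpM2l; last exact: ltW.
  by rewrite mulr_ge0 ?exprn_ge0 ?(ltW M0)// divr_ge0// subr_ge0 ltW.
by rewrite le_eqVlt; apply/orP; left; apply/eqP; ring.
Unshelve. all: by end_near. Qed.

(** * Convergence of tail means of quadratic functions *)

Lemma tail_mean_le (f g : V -> R) n w :
  (forall z, f z <= g z) -> tail_mean f n w <= tail_mean g n w.
Proof. by move=> fg; rewrite ler_wpM2r// ler_sum. Qed.

Lemma tail_meanD (f g : V -> R) n w :
  tail_mean (fun z => f z + g z) n w = tail_mean f n w + tail_mean g n w.
Proof. by rewrite /tail_mean big_split/= mulrDl. Qed.

Lemma tail_meanZ (a : R) (f : V -> R) n w :
  tail_mean (fun z => a * f z) n w = a * tail_mean f n w.
Proof. by rewrite /tail_mean -mulr_sumr mulrA. Qed.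

Definition excess (g : V -> R) (z : V) : R := g z * \1_[set z : V | 1 < `|z|] z.

Definition tail_integral (g : V -> R) : R := fine (\int[mu]_z (excess g z)%:E)%E.

Let mnorm t : measurable ([set z : V | t < `|z|] : set (borel_type V)).
Proof. exact: measurable_superlevel (@norm_continuous R V). Qed.

Lemma measurable_excess (g : V -> R) : continuous g ->
  measurable_fun setT (excess g : borel_type V -> R).
Proof.
move=> cg; apply: measurable_funM; first exact: continuous_borel_measurable.
exact: measurable_indic.
Qed.

Section layers.
Variables (g : V -> R) (eps : R).
Hypothesis g_continuous : continuous g.
Hypothesis g_homogeneous : homogeneous 2 g.
Hypothesis g_ge0 : forall z, 0 <= g z.
Hypothesis g_le : forall z, g z <= `|z| ^+ 2.
Hypothesis eps_gt0 : 0 < eps.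

(** The constraint on the norm is part of the layer, so that the layers of g are the
    superlevel sets of its excess. *)
Definition layer (j : nat) := [set z : V | j.+1%:R * eps < g z /\ 1 < `|z|].

Definition layer_sum (J : nat) (z : V) := \sum_(0 <= j < J) eps * \1_(layer j) z.

Let je_gt0 j : 0 < j.+1%:R * eps. Proof. by rewrite mulr_gt0. Qed.

Lemma measurable_layer j : measurable (layer j : set (borel_type V)).
Proof.
have := measurableI _ _ (measurable_superlevel (j.+1%:R * eps) g_continuous) (mnorm 1).
by congr measurable; apply/seteqP; split => z /=.
Qed.

Lemma bounded_away_layer j : bounded_away (layer j).
Proof. by exists 1 => //; apply/seteqP; split => z //= -[[_ /lt_trans h] /h]; rewrite ltxx. Qed.

Lemma mu_superlevel_lty (c : R) : 0 < c -> (mu [set z | (c < g z)%R] < +oo)%E.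
Proof.
move=> c0; case: Z_rv => _ _ [_ +] _ _; apply; first exact: measurable_superlevel.
exists (Num.sqrt c); first by rewrite sqrtr_gt0.
apply/seteqP; split => z //= -[cz zc].
have : g z < c.
  apply: (le_lt_trans (g_le z)).
  by rewrite -[ltRHS]sqr_sqrtr ?ltW// ltrXn2r// ?nnegrE// sqrtr_ge0.
by move=> /(lt_trans cz); rewrite ltxx.
Qed.

Lemma layer_sum_whp J (e : R) : 0 < e ->
  whp P (fun n w => `|tail_mean (layer_sum J) n w -
    \sum_(0 <= j < J) eps * fine (mu (layer j))| <= e).
Proof.
elim: J e => [|J IH] e e0.
  move=> eta eta0; near=> n; exists set0; split => //.
    by rewrite measure0 lee_fin ltW.
  move=> w _; rewrite big_geq// /tail_mean big1 ?mul0r ?subrr ?normr0 ?ltW//.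
  by move=> i _; rewrite /layer_sum big_geq.
have e2 : 0 < e / 2 by rewrite divr_gt0.
have e3 : 0 < e / 2 / eps by rewrite divr_gt0.
have := whp_and (IH _ e2) (tail_mean_indic (measurable_layer J) (bounded_away_layer J)
    (mu_boundary_null alpha_gt0 mu_homogeneous mu_outside_ball g_continuous
       g_homogeneous isT (je_gt0 J) ltr01 (mu_superlevel_lty (je_gt0 J))) e3).
move=> /whp_sub; apply; near=> n => w [].
set a := tail_mean _ _ _; set b' := tail_mean _ _ _ => h1 h2.
have -> : tail_mean (layer_sum J.+1) n w = a + eps * b'.
  rewrite -tail_meanZ -tail_meanD; congr (_ / _); apply: eq_bigr => i _.
  by rewrite /layer_sum big_nat_recr.
rewrite big_nat_recr//= opprD addrACA -mulrBr.
apply: (le_trans (ler_normD _ _)); rewrite [e]splitr lerD//.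
by rewrite normrM gtr0_norm// mulrC -ler_pdivlMr.
Unshelve. all: by end_near. Qed.

(** Up to height J.+1 eps the layers approximate the excess within eps.  Where the
    excess is larger, |z|^2 >= g z > M^2 and |z|^2 bounds the whole excess. *)
Lemma layer_sum_bounds J (M : R) z : 1 <= M -> M ^+ 2 <= J.+1%:R * eps ->
  layer_sum J z <= excess g z /\
  excess g z <= layer_sum J z +
    (eps * \1_[set z : V | 1 < `|z|] z + `|z| ^+ 2 * \1_[set z : V | M < `|z|] z).
Proof.
move=> M1 MJ.
have x0 : 0 <= excess g z by rewrite mulr_ge0.
have -> : layer_sum J z = \sum_(0 <= j < J) eps * (j.+1%:R * eps < excess g z)%R%:R.
  apply: eq_bigr => j _; congr (_ * _); rewrite indicE /excess indicE; congr (_%:R).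
  have [z1|z1] := ltP 1 `|z|.
    rewrite [z \in [set _ | 1 < _]]mem_set// mulr1.
    have [gz|gz] := ltP (j.+1%:R * eps) (g z); first by rewrite mem_set.
    by rewrite memNset// => -[/=]; rewrite ltNge gz.
  rewrite !memNset ?mulr0 ?ltNge ?(ltW (je_gt0 j))//= => [|[_]]; by rewrite ltNge z1.
have [h1 h2] := layer_cake_sum J eps_gt0 x0; split => //.
set S := (\sum_(_ <= _ < _) _) in h1 h2 *.
have i0 (A : set V) : 0 <= \1_A z :> R by [].
have [z1|z1] := ltP 1 `|z|; last first.
  have -> : excess g z = 0.
    by rewrite /excess indicE memNset ?mulr0//= ltNge z1.
  rewrite addr_ge0//; first by apply: sumr_ge0 => j _; rewrite mulr_ge0// ltW.
  by rewrite addr_ge0// mulr_ge0 ?sqr_ge0// ltW.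
rewrite [\1_[set z : V | 1 < _] z]indicE mem_set// mulr1.
have [/h2 h|h] := leP (excess g z) (J.+1%:R * eps).
  by rewrite addrA; apply: (le_trans h); rewrite lerDl mulr_ge0 ?sqr_ge0.
have eg : excess g z <= `|z| ^+ 2.
  by apply: le_trans (g_le z); apply: ler_piMr => //; rewrite indicE lern1 leq_b1.
have Mz : M < `|z|.
  rewrite ltNge; apply/negP => zM.
  have : `|z| ^+ 2 <= M ^+ 2 by rewrite lerXn2r ?nnegrE// (le_trans _ zM).
  by rewrite leNgt (le_lt_trans MJ (lt_le_trans h eg)).
rewrite [\1_[set z : V | M < _] z]indicE mem_set// mulr1.
apply: (le_trans eg); rewrite addrA lerDr; apply: addr_ge0; last exact: ltW.
by apply: sumr_ge0 => j _; rewrite mulr_ge0// ltW.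
Qed.

End layers.

Section nonnegative_excess.
Variable g : V -> R.
Hypothesis g_continuous : continuous g.
Hypothesis g_homogeneous : homogeneous 2 g.
Hypothesis g_ge0 : forall z, 0 <= g z.
Hypothesis g_le : forall z, g z <= `|z| ^+ 2.

Lemma integral_layer_sum (eps : R) J : 0 < eps ->
  (\int[mu]_z (layer_sum g eps J z)%:E =
   (\sum_(0 <= j < J) eps * fine (mu (layer g eps j)))%:E)%E.
Proof.
move=> eps0.
have mL j : measurable (layer g eps j : set (borel_type V)).
  exact: (measurable_layer eps g_continuous j).
rewrite ge0_integral_real_sum; last 2 first.
- move=> j; apply: measurable_funM => //.
- by move=> j z; rewrite mulr_ge0// ltW.
rewrite -sumEFin; apply: eq_bigr => j _.
under eq_integral do rewrite EFinM.
rewrite ge0_integralZl_EFin ?(ltW eps0)//; last first.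
  by apply/measurable_EFinP; exact: measurable_indic.
rewrite integral_indic// setIT EFinM fineK// ge0_fin_numE//.
apply: le_lt_trans (mu_superlevel_lty g_continuous g_le (c := j.+1%:R * eps) _).
  apply: le_measure; rewrite ?inE//; first exact: measurable_superlevel.
  by move=> z [].
by rewrite mulr_gt0.
Qed.

Let remainder (eps M : R) (z : V) : R :=
  eps * \1_[set z : V | 1 < `|z|] z + `|z| ^+ 2 * \1_[set z : V | M < `|z|] z.

Let remainder_ge0 eps M z : 0 < eps -> 0 <= remainder eps M z.
Proof. by move=> eps0; rewrite addr_ge0// mulr_ge0 ?sqr_ge0// ltW. Qed.

Let measurable_norm2 t :
  measurable_fun setT (fun z : borel_type V => `|z : V| ^+ 2 * \1_[set z : V | t < `|z|] z).
Proof.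
apply: measurable_funM; last exact: measurable_indic.
by apply: measurable_funX; exact: continuous_borel_measurable (@norm_continuous R V).
Qed.

Let measurable_remainder eps M : measurable_fun setT (remainder eps M : borel_type V -> R).
Proof.
apply: measurable_funD; last exact: measurable_norm2.
by apply: measurable_funM => //; exact: measurable_indic.
Qed.

Let integral_remainder (kappa : {measure set (borel_type V) -> \bar R}) eps M : 0 < eps ->
  (\int[kappa]_z (remainder eps M z)%:E = eps%:E * kappa [set z | (1 < `|z|)%R] +
    \int[kappa]_(z in [set z : V | (M < `|z|)%R]) (`|z| ^+ 2)%:E)%E.
Proof.
move=> eps0; under eq_integral do rewrite EFinD.
rewrite ge0_integralD//; last 3 first.
- by move=> z _; rewrite lee_fin mulr_ge0// ltW.
- by apply/measurable_EFinP; apply: measurable_funM => //; exact: measurable_indic.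
- by apply/measurable_EFinP; exact: measurable_norm2.
congr (_ + _)%E; last by rewrite integral_mul_indic.
under eq_integral do rewrite EFinM.
rewrite ge0_integralZl_EFin ?(ltW eps0)//; last first.
  by apply/measurable_EFinP; exact: measurable_indic.
by rewrite integral_indic// setIT.
Qed.

Let excess_ge0 z : 0 <= excess g z.
Proof. by rewrite mulr_ge0. Qed.

Lemma layer_approximation (theta : R) : 0 < theta -> exists J M, [/\ 1 <= M,
  forall z, layer_sum g theta J z <= excess g z <= layer_sum g theta J z + remainder theta M z,
  (\int[mu]_z (remainder theta M z)%:E <= (2 * theta)%:E)%E &
  \forall n \near \oo, (\int[P]_w (tail_mean (remainder theta M) n w)%:E <= (3 * theta)%:E)%E].
Proof.
move=> theta0; have [M [M1 muM nM]] := tail_second_moment_small theta0.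
exists (Num.truncn (M ^+ 2 / theta)), M; split => //.
- move=> z; apply/andP; apply: layer_sum_bounds => //.
  by rewrite -ler_pdivrMr// ltW// truncnS_gt.
- rewrite integral_remainder// mu_outside_ball mule1.
  by rewrite (_ : 2 * theta = theta + theta) 1?EFinD ?leeD2l//; ring.
near=> n.
rewrite expectation_tail_mean//; last by move=> z; exact: remainder_ge0.
rewrite integral_remainder// ge0_muleDr; last 2 first.
- by rewrite mule_ge0// lee_fin ltW.
- by apply: integral_ge0 => z _; rewrite lee_fin sqr_ge0.
rewrite (_ : 3 * theta = 2 * theta + theta) 1?EFinD; last by ring.
apply: leeD; last by near: n.
have s0 : 0 < tail_scale n by near: n; exact: tail_scale_gt0.
rewrite muleCA.
have q2 : n%:R / (k n)%:R * survival (tail_scale n * 1) < 2.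
  near: n; apply: (cvgr_lt _ (scaled_survival_cvg ltr01)).
  by rewrite powR1 ltr1n.
apply: (@le_trans _ _ (theta%:E * ((n%:R / (k n)%:R)%:E * (survival (tail_scale n * 1))%:E))%E).
  by rewrite -scaled_law_norm.
by rewrite -!EFinM lee_fin [2 * theta]mulrC ler_pM2l// ltW.
Unshelve. all: by end_near. Qed.

Let measurable_layer_sum (eps : R) J :
  measurable_fun setT (layer_sum g eps J : borel_type V -> R).
Proof.
apply: measurable_sum => j; apply: measurable_funM; first exact: measurable_cst.
by apply: measurable_indic; exact: (measurable_layer eps g_continuous j).
Qed.

Let integral_layer_remainder eps J M : 0 < eps ->
  (\int[mu]_z (layer_sum g eps J z + remainder eps M z)%:E =
   (\sum_(0 <= j < J) eps * fine (mu (layer g eps j)))%:E +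
     \int[mu]_z (remainder eps M z)%:E)%E.
Proof.
move=> eps0; rewrite -integral_layer_sum//.
under eq_integral do rewrite EFinD.
rewrite ge0_integralD; [by []|by []| | | |].
- by move=> z _; rewrite lee_fin sumr_ge0// => j _; rewrite mulr_ge0// ltW.
- by apply/measurable_EFinP; exact: measurable_layer_sum.
- by move=> z _; rewrite lee_fin remainder_ge0.
- by apply/measurable_EFinP; exact: measurable_remainder.
Qed.

Let integral_excess_le eps J M : 0 < eps ->
  (forall z, excess g z <= layer_sum g eps J z + remainder eps M z) ->
  (\int[mu]_z (excess g z)%:E <= (\sum_(0 <= j < J) eps * fine (mu (layer g eps j)))%:E +
     \int[mu]_z (remainder eps M z)%:E)%E.
Proof.
move=> eps0 zJ; rewrite -integral_layer_remainder//.
apply: ge0_le_integral; [by []| | | |].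
- by move=> z _; rewrite lee_fin.
- by apply/measurable_EFinP; exact: measurable_excess.
- by apply/measurable_EFinP; apply: measurable_funD;
    [exact: measurable_layer_sum|exact: measurable_remainder].
- by move=> z _; rewrite lee_fin.
Qed.

Lemma integral_excess_lty : (\int[mu]_z (excess g z)%:E < +oo)%E.
Proof.
have [J [M [M1 zJ muJ _]]] := layer_approximation ltr01.
have h z : excess g z <= layer_sum g 1 J z + remainder 1 M z by have /andP[] := zJ z.
apply: le_lt_trans (integral_excess_le ltr01 h) _.
by rewrite lte_add_pinfty ?ltry// (le_lt_trans muJ)// ltry.
Qed.

Lemma integral_excess_fin_num : (\int[mu]_z (excess g z)%:E)%E \is a fin_num.
Proof.
rewrite ge0_fin_numE; first exact: integral_excess_lty.
by apply: integral_ge0 => z _; rewrite lee_fin.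
Qed.

(** The tail mean of the excess lies between that of the layers, which converges, and
    the same plus that of the remainder, which is small in mean. *)
Lemma tail_mean_excess_ge0 (e : R) : 0 < e ->
  whp P (fun n w => `|tail_mean (excess g) n w - tail_integral g| <= e).
Proof.
move=> e0 eta eta0.
(* The bias 2 theta is at most e / 4, and Markov's inequality at level e / 4 for a mean
   of 3 theta gives eta / 2. *)
pose theta := Num.min (e / 8) (e * eta / 24).
have theta0 : 0 < theta by rewrite lt_min !divr_gt0// mulr_gt0.
have theta1 : theta <= e / 8 by rewrite ge_min lexx.
have theta2 : theta <= e * eta / 24 by rewrite ge_min lexx orbT.
have [J [M [M1 zJ muJ nJ]]] := layer_approximation theta0.
set c := \sum_(0 <= j < J) theta * fine (mu (layer g theta j)).
have c_le : c <= tail_integral g.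
  rewrite -lee_fin fineK ?integral_excess_fin_num//.
  rewrite -integral_layer_sum//; apply: ge0_le_integral; [by []| | | |].
  - by move=> z _; rewrite lee_fin sumr_ge0// => j _; rewrite mulr_ge0// ltW.
  - by apply/measurable_EFinP; exact: measurable_layer_sum.
  - by apply/measurable_EFinP; exact: measurable_excess.
  - by move=> z _; rewrite lee_fin; have /andP[] := zJ z.
have c_ge : tail_integral g <= c + 2 * theta.
  rewrite -lee_fin fineK ?integral_excess_fin_num//.
  apply: (@le_trans _ _ (c%:E + \int[mu]_z (remainder theta M z)%:E)%E).
    by apply: integral_excess_le => // z; have /andP[] := zJ z.
  by rewrite EFinD leeD2l.
have e4 : 0 < e / 4 by rewrite divr_gt0.
have eta2 : 0 < eta / 2 by rewrite divr_gt0.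
have lay := layer_sum_whp g_continuous g_homogeneous g_le theta0 J e4.
near=> n.
have [B1 [mB1 PB1 HB1]] : exists B, [/\ measurable B, (P B <= (eta / 2)%:E)%E &
    forall w, ~ B w -> `|tail_mean (layer_sum g theta J) n w - c| <= e / 4].
  by near: n; exact: lay.
have mT : measurable_fun setT (tail_mean (remainder theta M) n).
  apply: measurable_funM => //; apply: measurable_sum => i.
  apply: (measurableT_comp (measurable_remainder theta M)).
  by apply: measurable_scaling; case: Z_copies.
pose B2 := [set w | e / 4 < tail_mean (remainder theta M) n w].
have mB2 : measurable B2 by exact: measurable_gtr.
have PB2 : (P B2 <= (eta / 2)%:E)%E.
  have h : ((e / 4)%:E * P B2 <= (3 * theta)%:E)%E.
    apply: (@le_trans _ _ (\int[P]_w (tail_mean (remainder theta M) n w)%:E)%E); last by near: n.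
    apply: markov_set => //; last by move=> w /ltW.
    - by move=> w; rewrite mulr_ge0// sumr_ge0// => i _; exact: remainder_ge0.
    - exact: ltW.
  rewrite -(@lee_pmul2l _ (e / 4)%:E) ?lte_fin//; apply: (le_trans h).
  rewrite -EFinM lee_fin; lra.
exists (B1 `|` B2); split; first exact: measurableU.
  by rewrite [eta]splitr EFinD; apply: le_trans (measureU2 _ mB1 mB2) _; exact: leeD.
move=> w /not_orP[/HB1 w1 /negP]; rewrite -leNgt => w2.
have t1 : tail_mean (layer_sum g theta J) n w <= tail_mean (excess g) n w.
  by apply: tail_mean_le => z; have /andP[] := zJ z.
have t2 : tail_mean (excess g) n w <=
    tail_mean (layer_sum g theta J) n w + tail_mean (remainder theta M) n w.
  by rewrite -tail_meanD; apply: tail_mean_le => z; have /andP[] := zJ z.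
move: w1; rewrite !ler_norml => /andP[w1 w1'].
by apply/andP; split; lra.
Unshelve. all: by end_near. Qed.

End nonnegative_excess.

Section signed_excess.
Variable g : V -> R.
Hypothesis g_continuous : continuous g.
Hypothesis g_homogeneous : homogeneous 2 g.
Hypothesis g_le : forall z, `|g z| <= `|z| ^+ 2.

Let gp z := (`|g z| + g z) / 2.
Let gn z := (`|g z| - g z) / 2.

Let cont_norm_g : continuous (fun z => `|g z|).
Proof. by move=> z; apply: cvg_norm; exact: g_continuous. Qed.

Let gp_continuous : continuous gp.
Proof.
move=> z; apply: cvgM; last exact: cvg_cst.
by apply: cvgD; [exact: cont_norm_g|exact: g_continuous].
Qed.

Let gn_continuous : continuous gn.
Proof.
move=> z; apply: cvgM; last exact: cvg_cst.
by apply: cvgB; [exact: cont_norm_g|exact: g_continuous].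
Qed.

Let gp_homogeneous : homogeneous 2 gp.
Proof. by move=> t z t0; rewrite /gp g_homogeneous// normrM gtr0_norm ?exprn_gt0//; ring. Qed.

Let gn_homogeneous : homogeneous 2 gn.
Proof. by move=> t z t0; rewrite /gn g_homogeneous// normrM gtr0_norm ?exprn_gt0//; ring. Qed.

Let g_norm z : - `|g z| <= g z <= `|g z|. Proof. by rewrite -ler_norml. Qed.

Let gp_ge0 z : 0 <= gp z. Proof. by have /andP[] := g_norm z; rewrite /gp; lra. Qed.

Let gn_ge0 z : 0 <= gn z. Proof. by have /andP[] := g_norm z; rewrite /gn; lra. Qed.

Let gp_le z : gp z <= `|z| ^+ 2.
Proof. by apply: le_trans (g_le z); have /andP[] := g_norm z; rewrite /gp; lra. Qed.

Let gn_le z : gn z <= `|z| ^+ 2.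
Proof. by apply: le_trans (g_le z); have /andP[] := g_norm z; rewrite /gn; lra. Qed.

Let excessB z : excess g z = excess gp z + -1 * excess gn z.
Proof. by rewrite /excess /gp /gn; field. Qed.

Let integrable_part (h : V -> R) : continuous h -> homogeneous 2 h -> (forall z, 0 <= h z) ->
  (forall z, h z <= `|z| ^+ 2) -> mu.-integrable setT (fun z => (excess h z)%:E).
Proof.
move=> ch hh h0 hle; apply/integrableP; split.
  by apply/measurable_EFinP; exact: measurable_excess.
under eq_integral do rewrite gee0_abs ?lee_fin ?mulr_ge0//.
exact: integral_excess_lty.
Qed.

Let tail_integralB : tail_integral g = tail_integral gp - tail_integral gn.
Proof.
rewrite /tail_integral.
have -> : (fun z => (excess g z)%:E) = (fun z => (excess gp z)%:E - (excess gn z)%:E)%E.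
  by apply/funext => z; rewrite excessB mulN1r.
rewrite integralB//; [|exact: integrable_part..].
by rewrite fineB//; exact: integral_excess_fin_num.
Qed.

(** Reduces to the nonnegative case through g = (|g| + g) / 2 - (|g| - g) / 2, whose
    two parts are again continuous, homogeneous and bounded by |z|^2. *)
Lemma tail_mean_excess (e : R) : 0 < e ->
  whp P (fun n w => `|tail_mean (excess g) n w - tail_integral g| <= e).
Proof.
move=> e0; have e2 : 0 < e / 2 by rewrite divr_gt0.
have := whp_and (tail_mean_excess_ge0 gp_continuous gp_homogeneous gp_ge0 gp_le e2)
  (tail_mean_excess_ge0 gn_continuous gn_homogeneous gn_ge0 gn_le e2).
move=> /whp_sub; apply; near=> n => w [h1 h2].
have -> : tail_mean (excess g) n w = tail_mean (excess gp) n w - tail_mean (excess gn) n w.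
  rewrite -mulN1r -tail_meanZ -tail_meanD; congr (_ / _); apply: eq_bigr => i _.
  exact: excessB.
rewrite tail_integralB opprB addrACA [_ + (_ - _)]addrC [e]splitr.
move: h1 h2; rewrite !ler_norml => /andP[h1 h2] /andP[h3 h4]; apply/andP; split; lra.
Unshelve. all: by end_near. Qed.

End signed_excess.

Lemma tail_mean_norm_gt (t e : R) : 0 < t -> 0 < e ->
  whp P (fun n w => `|tail_mean \1_[set z : V | t < `|z|] n w - t `^ (- alpha)| <= e).
Proof.
move=> t0 e0; rewrite (_ : t `^ (- alpha) = fine (mu [set z : V | (t < `|z|)%R])).
  apply: tail_mean_indic => //; [exact: bounded_away_norm|exact: tail_boundary_null].
by rewrite mu_norm.
Qed.

(** * Sums over the largest observations *)

Definition order_stat n w := kth_largest (k n) [seq `|Z_ i w| | i <- iota 0 n].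

Definition top_sum (g : V -> R) n w :=
  \sum_(0 <= i < n | order_stat n w <= `|Z_ i w|) g (Z_ i w).

Lemma tail_mean_count t n w : 0 < tail_scale n ->
  tail_mean \1_[set z : V | t < `|z|] n w =
  (count (fun x => (tail_scale n * t < x)%R) [seq `|Z_ i w| | i <- iota 0 n])%:R / (k n)%:R.
Proof.
move=> s0; rewrite /tail_mean; congr (_ / _).
rewrite count_map -sum1_count natr_sum [RHS]big_mkcond/= /index_iota subn0.
apply: eq_bigr => i _; rewrite indicE -scaled_norm_gt//.
have [h|h] := ltP t `|(tail_scale n)^-1 *: Z_ i w|; first by rewrite mem_set.
by rewrite memNset//= ltNge h.
Qed.

Lemma order_stat_gt t n w : 0 < tail_scale n -> (0 < k n <= n)%N ->
  (tail_scale n * t < order_stat n w) = (1 <= tail_mean \1_[set z : V | t < `|z|] n w).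
Proof.
move=> s0 /andP[k0 kn].
rewrite lt_kth_largest ?size_map ?size_iota ?k0// tail_mean_count//.
by rewrite ler_pdivlMr ?ltr0n// mul1r ler_nat.
Qed.

(** By homogeneity g (Z_i) = s^2 g (Z_i / s).  The thresholds 1 and the scaled order
    statistic both lie between t1 and t2, so they classify Z_i / s differently only
    if t1 < |Z_i / s| <= t2, where |g| <= t2^2. *)
Lemma top_sum_approx (g : V -> R) (t1 t2 : R) n w :
  homogeneous 2 g -> (forall z, `|g z| <= `|z| ^+ 2) ->
  0 < tail_scale n -> (0 < k n)%N -> 0 < t1 -> t1 < 1 -> 1 < t2 ->
  tail_scale n * t1 < order_stat n w -> order_stat n w <= tail_scale n * t2 ->
  `|top_sum g n w / ((k n)%:R * tail_scale n ^+ 2) - tail_mean (excess g) n w| <=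
  t2 ^+ 2 * (tail_mean \1_[set z : V | t1 < `|z|] n w - tail_mean \1_[set z : V | t2 < `|z|] n w).
Proof.
move=> hg gle s0 k0 t10 t11 t21 r1 r2.
have kR : 0 < (k n)%:R :> R by rewrite ltr0n.
have -> : top_sum g n w / ((k n)%:R * tail_scale n ^+ 2) =
    (\sum_(0 <= i < n) (if order_stat n w <= `|Z_ i w| then g ((tail_scale n)^-1 *: Z_ i w) else 0)) / (k n)%:R.
  rewrite invfM mulrCA mulrC; congr (_ / _); rewrite -big_mkcond/= /top_sum mulr_suml.
  by apply: eq_bigr => i _; rewrite hg ?invr_gt0// exprVn mulrC.
rewrite /tail_mean -!mulrBl -!sumrB normrM normfV (gtr0_norm kR) mulrA ler_pM2r ?invr_gt0//.
rewrite mulr_sumr; apply: (le_trans (ler_norm_sum _ _ _)); apply: ler_sum => i _.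
rewrite !indicE /excess indicE.
set y := (tail_scale n)^-1 *: Z_ i w.
have yE t : (y \in [set z : V | t < `|z|]) = (tail_scale n * t < `|Z_ i w|).
  by rewrite -scaled_norm_gt//; apply/idP/idP; rewrite inE.
have yn : `|Z_ i w| = tail_scale n * `|y|.
  by rewrite normrZ normfV gtr0_norm// mulVKf ?gt_eqF.
rewrite !yE mulr1 {yE}.
set zi := `|Z_ i w| in yn *.
have [h1|h1] := ltP (tail_scale n * t1) zi; last first.
  have h2 : zi <= tail_scale n * t2 by apply: (le_trans h1); rewrite ler_pM2l// ltW// (lt_trans t11).
  have h3 : zi <= tail_scale n * 1 by apply: (le_trans h1); rewrite ler_pM2l// ltW.
  rewrite mulr1 in h3.
  have -> : (order_stat n w <= zi) = false by rewrite leNgt (le_lt_trans h1 r1).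
  have -> : (tail_scale n < zi) = false by rewrite ltNge h3.
  have -> : (tail_scale n * t2 < zi) = false by rewrite ltNge h2.
  by rewrite mulr0 !subr0 normr0 mulr0.
have [h2|h2] := ltP (tail_scale n * t2) zi.
  rewrite (le_trans r2 (ltW h2)) (_ : tail_scale n < zi); last first.
    by apply: lt_trans h2; rewrite -[ltLHS]mulr1 ltr_pM2l.
  by rewrite mulr1 !subrr normr0 mulr0.
rewrite subr0 mulr1.
have gy : `|g y| <= t2 ^+ 2.
  apply: (le_trans (gle y)); rewrite lerXn2r ?nnegrE//; first lra.
  by rewrite -(ler_pM2l s0) -yn.
case: ifP => _; case: ltP => _; rewrite ?mulr1 ?mulr0 ?subrr ?subr0 ?normr0 ?sub0r ?normrN//.
- exact: sqr_ge0.
- exact: sqr_ge0.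
Qed.

(** With t1^-alpha = 1 + u and t2^-alpha = 1 / (1 + u) the limits of the two counts are
    explicit, on either side of 1 and at distance of order u. *)
Lemma top_sum_whp (g : V -> R) (e : R) : continuous g -> homogeneous 2 g ->
  (forall z, `|g z| <= `|z| ^+ 2) -> 0 < e ->
  whp P (fun n w => `|top_sum g n w / ((k n)%:R * tail_scale n ^+ 2) - tail_integral g| <= e).
Proof.
move=> cg hg gle e0.
pose u := Num.min 1 (e / 24).
have u0 : 0 < u by rewrite lt_min ltr01 divr_gt0.
have u1 : u <= 1 by rewrite ge_min lexx.
have u2 : u <= e / 24 by rewrite ge_min lexx orbT.
pose t1 := (1 + u) `^ (- alpha^-1); pose t2 := (1 + u) `^ alpha^-1.
have up : 0 < 1 + u by rewrite addr_gt0.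
have an : alpha != 0 by rewrite gt_eqF.
have t10 : 0 < t1 by rewrite powR_gt0.
have t20 : 0 < t2 by rewrite powR_gt0.
have t21 : 1 < t2.
  have := @gt0_ltr_powR R alpha^-1; rewrite invr_gt0 => /(_ alpha_gt0 1 (1 + u)).
  by rewrite powR1 !nnegrE; apply; lra.
have t11 : t1 < 1 by rewrite /t1 powRN invf_lt1.
have t2u : t2 <= 1 + u.
  apply: ler1_powR; first by lra.
  by rewrite invf_le1// ltW// (lt_trans _ alpha_gt2)// ltr1n.
have p1 : t1 `^ (- alpha) = 1 + u.
  by rewrite /t1 -powRrM mulrNN mulVf// powRr1 ?ltW.
have p2 : t2 `^ (- alpha) = (1 + u)^-1.
  by rewrite /t2 -powRrM mulrN mulVf// powR_inv1 ?ltW.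
have u4 : 0 < u / 4 by rewrite divr_gt0.
have e2 : 0 < e / 2 by rewrite divr_gt0.
have W := whp_and (whp_and (tail_mean_norm_gt t10 u4) (tail_mean_norm_gt t20 u4))
  (tail_mean_excess cg hg gle e2).
apply: (whp_sub W); near=> n => w [[]].
have s0 : 0 < tail_scale n by near: n; exact: tail_scale_gt0.
have k0 : (0 < k n)%N by near: n; exact: k_gt0.
have kn : (k n <= n)%N by near: n; exact: (k_le k_small).
rewrite p1 p2 => h1 h2 h3.
have [A1 B1 AB] := threshold_counts u0 u1 u2 t20 t2u h1 h2.
have r1 : tail_scale n * t1 < order_stat n w by rewrite order_stat_gt ?k0.
have r2 : order_stat n w <= tail_scale n * t2 by rewrite leNgt order_stat_gt ?k0// -ltNge.
have h4 := top_sum_approx hg gle s0 k0 t10 t11 t21 r1 r2.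
have D0 := le_trans (normr_ge0 _) h4; rewrite pmulr_rge0 ?exprn_gt0// in D0.
rewrite -(subrK (tail_mean (excess g) n w) (top_sum g n w / _)) -addrA.
apply: (le_trans (ler_normD _ _)); rewrite [e]splitr lerD//.
exact: le_trans h4 (AB D0).
Unshelve. all: by end_near. Qed.

Lemma measurable_copy i : measurable_fun setT (Z_ i : Omega -> borel_type V).
Proof. by case: Z_copies. Qed.

Lemma measurable_norm_copy i : measurable_fun setT (fun w => `|Z_ i w|).
Proof.
exact: measurableT_comp (continuous_borel_measurable (@norm_continuous R V)) (measurable_copy i).
Qed.

(** The event that the k-th largest norm exceeds t says that at least k norms do, and
    a count is a sum of indicators. *)
Lemma measurable_order_stat n : (0 < k n <= n)%N -> measurable_fun setT (order_stat n).
Proof.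
move=> kn; apply: (measurability _ (RGenOInfty.measurableE R)).
move=> _ [_ [t ->] <-]; rewrite setTI set_itvE.
pose N w : R := \sum_(0 <= i < n) \1_[set w | t < `|Z_ i w|] w.
rewrite (_ : _ @^-1` _ = [set w | (k n).-1%:R < N w]).
  apply: measurable_gtr; apply: measurable_sum => i; apply: measurable_indic.
  by apply: measurable_gtr; exact: measurable_norm_copy.
have NE w : N w = (count (fun x => (t < x)%R) [seq `|Z_ i w| | i <- iota 0 n])%:R.
  rewrite count_map -sum1_count natr_sum [RHS]big_mkcond/= /N /index_iota subn0.
  apply: eq_bigr => i _; rewrite indicE.
  have [h|h] := ltP t `|Z_ i w|; first by rewrite mem_set.
  by rewrite memNset//= ltNge h.
have k0 : (0 < k n)%N by case/andP: kn.
apply/seteqP; split => w /=; rewrite NE ltr_nat prednK//;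
  by rewrite lt_kth_largest// size_map size_iota.
Qed.

Lemma measurable_top_sum g n : continuous g -> (0 < k n <= n)%N ->
  measurable_fun setT (top_sum g n).
Proof.
move=> cg kn; rewrite /top_sum.
under eq_fun do rewrite big_mkcond/=.
apply: measurable_sum => i; apply: measurable_fun_ifT => //.
- apply: measurable_fun_ler; first exact: measurable_order_stat.
  exact: measurable_norm_copy.
- exact: measurableT_comp (continuous_borel_measurable cg) (measurable_copy i).
Qed.

(** If the integral vanished, so would the mass of {h > 1}, on which the integrand is
    at least 1; by homogeneity h would vanish mu-almost everywhere. *)
Lemma tail_integral_sq_gt0 (h : V -> R) : continuous h -> homogeneous 1 h ->
  (forall z, 0 <= h z) -> (forall z, h z <= `|z|) -> mu [set z | (0 < h z)%R] <> 0%E ->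
  0 < tail_integral (fun z => h z ^+ 2).
Proof.
move=> ch hh h0 hle hmu.
have c2 : continuous (fun z => h z ^+ 2) by move=> z; apply: cvgM; exact: ch.
have p2 z : 0 <= h z ^+ 2 by exact: sqr_ge0.
have l2 z : h z ^+ 2 <= `|z| ^+ 2 by rewrite lerXn2r ?nnegrE.
have fin := integral_excess_fin_num c2 p2 l2.
rewrite lt_neqAle fine_ge0 ?andbT; last first.
  by apply: integral_ge0 => z _; rewrite lee_fin mulr_ge0.
apply/eqP => /esym I0; apply: hmu; apply: (mu_positive_null mu_homogeneous ch hh).
apply/eqP; rewrite eq_le measure_ge0 andbT.
have := @markov_set _ (borel_type V) R mu (excess (fun z => h z ^+ 2)) [set z | 1 < h z] 1.
rewrite mul1e -[X in (_ <= X)%E]fineK// -/(tail_integral _) I0; apply => //.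
- exact: measurable_excess.
- by move=> z; rewrite mulr_ge0.
- exact: measurable_superlevel.
- move=> z /= z1; rewrite /excess indicE mem_set ?mulr1//=; last exact: lt_le_trans (hle z).
  by rewrite exprn_ege1// ltW.
Qed.

End tail_empirical.

(** * The inner product on L2 x L2 *)

Section inner_product.
Context dT (T : measurableType dT) (R : realType).
Variable nu : {measure set T -> \bar R}.
Implicit Types f g : L2 nu.

Lemma mul_Lfun2_integrable (f g : T -> R) : f \in Lfun nu 2%:E -> g \in Lfun nu 2%:E ->
  nu.-integrable setT (fun t => (f t * g t)%:E).
Proof. by move=> f2 g2; apply/Lfun1_integrable; exact: Lfun2_mul_Lfun1. Qed.

Lemma L2inner_ae f1 g1 (f g : T -> R) : measurable_fun setT f -> measurable_fun setT g ->
  (f1 : T -> R) = f %[ae nu] -> (g1 : T -> R) = g %[ae nu] ->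
  L2inner f1 g1 = \int[nu]_t (f t * g t).
Proof.
move=> mf mg f1f g1g; congr fine; apply: ae_eq_integral => //.
- by apply/measurable_EFinP; apply: measurable_funM; exact: L2val_measurable.
- by apply/measurable_EFinP; apply: measurable_funM.
by apply: filterS2 f1f g1g => t /= E1 E2 _; rewrite E1// E2.
Qed.

Lemma L2norm_sq f : `|f| ^+ 2 = L2inner f f.
Proof.
rewrite L2_normE sqr_sqrtr//; apply: Rintegral_ge0 => t _.
by rewrite -expr2 sqr_ge0.
Qed.

(** Expresses the inner product through norms, from which its continuity, its
    homogeneity and the bound by |z|^2 follow. *)
Lemma L2inner_polarization f g : L2inner f g = (`|f + g| ^+ 2 - `|f - g| ^+ 2) / 4.
Proof.
have mf := L2val_measurable f; have mg := L2val_measurable g.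
have gN : (f - g : L2 nu) = (fun t => f t - g t) %[ae nu].
  apply: filterS2 (L2addE f (- g)) (L2oppE g) => t E1 E2 _.
  by rewrite E1// /= E2.
rewrite !L2norm_sq (L2inner_ae (f := f \+ g) (g := f \+ g) _ _ (L2addE f g) (L2addE f g));
  [|exact: measurable_funD..].
rewrite (L2inner_ae (f := fun t => f t - g t) (g := fun t => f t - g t) _ _ gN gN);
  [|exact: measurable_funB..].
rewrite -RintegralB//.
- have -> : (fun t => (f \+ g) t * (f \+ g) t - (f t - g t) * (f t - g t)) = (fun t => 4 * (f t * g t)).
    by apply/funext => t /=; ring.
  rewrite RintegralZl//; last by apply: mul_Lfun2_integrable; exact: L2valP.
  by rewrite mulrC mulKf.
- have fg : (f : T -> R) \+ g \in Lfun nu 2%:E.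
    exact: (proj2 (Lfun_addr_closed nu (lee1n 2)) _ _ (L2valP f) (L2valP g)).
  exact: mul_Lfun2_integrable.
- have fg : (fun t => f t - g t) \in Lfun nu 2%:E.
    have gNL := Lfun_oppr_closed (L2valP g).
    exact: (proj2 (Lfun_addr_closed nu (lee1n 2)) _ _ (L2valP f) gNL).
  exact: mul_Lfun2_integrable.
Qed.

Local Notation HH := (L2 nu * L2 nu)%type.

Lemma maxnormE (z : HH) : maxnorm z = `|z|.
Proof. by rewrite prod_normE. Qed.

Lemma continuous_inner : continuous (fun z : HH => L2inner z.1 z.2).
Proof.
rewrite (_ : (fun z : HH => L2inner z.1 z.2) =
  (fun z : HH => (`|z.1 + z.2| ^+ 2 - `|z.1 - z.2| ^+ 2) / 4)); last first.
  by apply/funext => z; exact: L2inner_polarization.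
move=> z; apply: cvgM; last exact: cvg_cst.
by apply: cvgB; rewrite !expr2; apply: cvgM; apply: cvg_norm;
  [apply: cvgD|apply: cvgD|apply: cvgB|apply: cvgB]; (exact: cvg_fst || exact: cvg_snd).
Qed.

Lemma continuous_norm1_sq : continuous (fun z : HH => `|z.1| ^+ 2).
Proof. by move=> z; apply: cvgM; apply: cvg_norm; exact: cvg_fst. Qed.

Lemma continuous_norm2_sq : continuous (fun z : HH => `|z.2| ^+ 2).
Proof. by move=> z; apply: cvgM; apply: cvg_norm; exact: cvg_snd. Qed.

Lemma homogeneous_inner : homogeneous (V := HH) 2 (fun z : HH => L2inner z.1 z.2).
Proof.
move=> t z t0; rewrite !L2inner_polarization /= -scalerDr -scalerBr !normrZ.
by rewrite !exprMn gtr0_norm//; ring.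
Qed.

Lemma homogeneous_norm1_sq : homogeneous (V := HH) 2 (fun z : HH => `|z.1| ^+ 2).
Proof. by move=> t z t0; rewrite /= normrZ exprMn gtr0_norm. Qed.

Lemma homogeneous_norm2_sq : homogeneous (V := HH) 2 (fun z : HH => `|z.2| ^+ 2).
Proof. by move=> t z t0; rewrite /= normrZ exprMn gtr0_norm. Qed.

Lemma norm1_sq_le (z : HH) : `|z.1| ^+ 2 <= `|z| ^+ 2.
Proof. by rewrite lerXn2r ?nnegrE// prod_normE le_max lexx. Qed.

Lemma norm2_sq_le (z : HH) : `|z.2| ^+ 2 <= `|z| ^+ 2.
Proof. by rewrite lerXn2r ?nnegrE// prod_normE le_max lexx orbT. Qed.

Lemma inner_le (z : HH) : `|L2inner z.1 z.2| <= `|z| ^+ 2.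
Proof.
have h (a b : L2 nu) : `|a| <= `|z| -> `|b| <= `|z| -> `|a + b| ^+ 2 <= 4 * `|z| ^+ 2.
  move=> ha hb; have -> : 4 * `|z| ^+ 2 = (`|z| + `|z|) ^+ 2 by ring.
  rewrite lerXn2r ?nnegrE ?addr_ge0//.
  by apply: (le_trans (ler_normD _ _)); exact: lerD.
have z1 : `|z.1| <= `|z| by rewrite prod_normE le_max lexx.
have z2 : `|z.2| <= `|z| by rewrite prod_normE le_max lexx orbT.
have h1 := h _ _ z1 z2.
have h2 : `|z.1 - z.2| ^+ 2 <= 4 * `|z| ^+ 2 by apply: h; rewrite ?normrN.
have p1 : 0 <= `|z.1 + z.2| ^+ 2 by exact: sqr_ge0.
have p2 : 0 <= `|z.1 - z.2| ^+ 2 by exact: sqr_ge0.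
rewrite L2inner_polarization ler_norml; apply/andP; split; lra.
Qed.

End inner_product.

(** * The correlation ratio *)

Section ratio.
Context (R : realType).

Lemma ratio_near (a p q e : R) : 0 < p -> 0 < q -> 0 < e ->
  exists2 delta, 0 < delta & forall a' p' q' : R,
    `|a' - a| <= delta -> `|p' - p| <= delta -> `|q' - q| <= delta ->
    `|a' / (Num.sqrt p' * Num.sqrt q') - a / (Num.sqrt p * Num.sqrt q)| <= e.
Proof.
move=> p0 q0 e0.
have F : (fun z : R * R * R => z.1.1 / (Num.sqrt z.1.2 * Num.sqrt z.2)) z @[z --> (a, p, q)]
    --> a / (Num.sqrt p * Num.sqrt q).
  have c2 : z.2 @[z --> (a, p, q)] --> q by exact: cvg_snd.
  have c1 : z.1 @[z --> (a, p, q)] --> (a, p) by exact: cvg_fst.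
  apply: cvgM; first exact: (cvg_comp _ _ c1 cvg_fst).
  apply: cvgV; first by rewrite mulf_neq0// gt_eqF// sqrtr_gt0.
  apply: cvgM.
    exact: (cvg_comp _ _ (cvg_comp _ _ c1 cvg_snd) (@sqrt_continuous R p)).
  exact: (cvg_comp _ _ c2 (@sqrt_continuous R q)).
move/cvgrPdist_le : F => /(_ _ e0) /nbhs_ballP[r /= r0 H].
exists (r / 2); first by rewrite divr_gt0.
move=> a' p' q' ha hp hq; rewrite distrC; apply: (H (a', p', q')).
have lr x : x <= r / 2 -> x < r by move=> ?; lra.
by split; [split|]; rewrite /ball/= distrC; exact: lr.
Qed.

Lemma measurable_ratio d (Omega : measurableType d) (a p q : Omega -> R) :
  measurable_fun setT a -> measurable_fun setT p -> measurable_fun setT q ->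
  measurable_fun setT (fun w => a w / (Num.sqrt (p w) * Num.sqrt (q w))).
Proof.
move=> ma mp mq.
have msqrt : measurable_fun setT (Num.sqrt : R -> R).
  by apply: nondecreasing_measurable => // x y; exact: ler_wsqrtr.
rewrite (_ : (fun w => _) = (fun w => a w * (Num.sqrt (p w) * Num.sqrt (q w)) `^ (-1))).
  apply: measurable_funM => //.
  apply: (measurableT_comp (measurable_powR (-1))).
  by apply: measurable_funM; exact: measurableT_comp.
by apply/funext => w; rewrite powR_inv1// mulr_ge0 ?sqrtr_ge0.
Qed.

(** Holds also when p or q vanishes, as inverses are total. *)
Lemma ratio_scale (a p q c : R) : 0 < c -> 0 <= p -> 0 <= q ->
  a / (Num.sqrt p * Num.sqrt q) =
  (a / c) / (Num.sqrt (p / c) * Num.sqrt (q / c)).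
Proof.
move=> c0 p0 q0; rewrite !sqrtrM// mulrACA -expr2 sqr_sqrtr ?invr_ge0 ?ltW//.
by rewrite [in RHS]invfM mulrACA invrK mulVf ?gt_eqF// mulr1.
Qed.

End ratio.

Unset Implicit Arguments.

Theorem corollary1 (R : realType)
    (dT : measure_display) (T : measurableType dT)
    (nu : {measure set T -> \bar R})
    (sepL2 : separable_space (L2 nu))
    (d : measure_display) (Omega : measurableType d) (P : probability Omega R)
    (X Y : Omega -> L2 nu) (X_ Y_ : nat -> Omega -> L2 nu)
    (alpha : R) (b : nat -> R)
    (mu : {measure set (borel_type (L2 nu * L2 nu)%type) -> \bar R})
    (k : nat -> nat) :
  measurable_fun setT (fun w => (X w, Y w) : borel_type (L2 nu * L2 nu)%type) ->
  has_mean P X 0 -> has_mean P Y 0 ->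
  2 < alpha ->
  regularly_varying P (fun w => (X w, Y w)) alpha b mu ->
  mu [set z : L2 nu * L2 nu | 1 < maxnorm z] = 1%E ->
  nondegenerate_M0 (marginalX mu) -> nondegenerate_M0 (marginalY mu) ->
  independent_copies P
    (fun i w => (X_ i w, Y_ i w) : borel_type (L2 nu * L2 nu)%type)
    (fun w => (X w, Y w)) ->
  k n @[n --> \oo] --> \oo ->
  (k n)%:R / n%:R @[n --> \oo] --> (0 : R) ->
  cvg_in_probability P
    (fun n w => rho_hat n (k n) (fun i => (X_ i w, Y_ i w))) (extremal_corr mu).
Proof.
move=> mZ _ _ alpha2 rv.
set HH : normedModType R := (L2 nu * L2 nu)%type.
have maxE : @maxnorm _ T R nu = (fun z : HH => `|z|) by apply/funext => z; exact: maxnormE.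
rewrite maxE => mu1 [_ [A mA muA]] [_ [B mB muB]] copies kinf ksmall.
pose Z_ i w : HH := (X_ i w, Y_ i w).
pose gXY (z : HH) := L2inner z.1 z.2.
pose gX (z : HH) := `|z.1| ^+ 2.
pose gY (z : HH) := `|z.2| ^+ 2.
have gX_le z : `|gX z| <= `|z| ^+ 2 by rewrite ger0_norm ?sqr_ge0// norm1_sq_le.
have gY_le z : `|gY z| <= `|z| ^+ 2 by rewrite ger0_norm ?sqr_ge0// norm2_sq_le.
have corrE : extremal_corr mu = tail_integral mu gXY /
    (Num.sqrt (tail_integral mu gX) * Num.sqrt (tail_integral mu gY)).
  rewrite /extremal_corr /sigma_XY /sigma_X /sigma_Y /tail_integral /excess !integral_mul_indic.
  by rewrite maxE.
have rhoE n w : rho_hat n (k n) (fun i => Z_ i w) =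
    top_sum Z_ k gXY n w / (Num.sqrt (top_sum Z_ k gX n w) * Num.sqrt (top_sum Z_ k gY n w)).
  by rewrite /rho_hat maxE.
have rvH : @regularly_varying R HH _ Omega P (fun w => (X w, Y w)) alpha b mu by exact: rv.
have cX : continuous (fun z : HH => z.1) by move=> z; exact: cvg_fst.
have cY : continuous (fun z : HH => z.2) by move=> z; exact: cvg_snd.
have positive (f : HH -> L2 nu) : continuous f -> homogeneous 1 (fun z : HH => `|f z|) ->
    (forall z, `|f z| <= `|z|) -> mu [set z | (0 < `|f z|)%R] <> 0%E ->
    0 < tail_integral mu (fun z : HH => `|f z| ^+ 2).
  move=> cf hf lf mf.
  have cn : continuous (fun z : HH => `|f z|) by move=> z; apply: cvg_norm; exact: cf.
  exact: (@tail_integral_sq_gt0 _ Omega R P HH (fun w => (X w, Y w)) Z_ alpha b mu k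
    mZ alpha2 rvH mu1 copies kinf ksmall (fun z : HH => `|f z|) cn hf (fun=> normr_ge0 _) lf mf).
have X_gt0 : 0 < tail_integral mu gX.
  apply: (positive (fun z => z.1) cX).
  - by move=> t z t0; rewrite [LHS]normrZ gtr0_norm.
  - by move=> z; rewrite prod_normE le_max lexx.
  - exact: (@norm_gt0_charged R HH (L2 nu) mu (fun z : HH => z.1) A cX mA muA).
have Y_gt0 : 0 < tail_integral mu gY.
  apply: (positive (fun z => z.2) cY).
  - by move=> t z t0; rewrite [LHS]normrZ gtr0_norm.
  - by move=> z; rewrite prod_normE le_max lexx orbT.
  - exact: (@norm_gt0_charged R HH (L2 nu) mu (fun z : HH => z.2) B cY mB muB).
have limit (g : HH -> R) (e : R) := @top_sum_whp _ Omega R P HH (fun w => (X w, Y w)) Z_ alpha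
  b mu k mZ alpha2 rvH mu1 copies kinf ksmall g e.
have WXY (e : R) := limit gXY e
  (@continuous_inner _ T R nu) (@homogeneous_inner _ T R nu) (@inner_le _ T R nu).
have WX (e : R) := limit gX e
  (@continuous_norm1_sq _ T R nu) (@homogeneous_norm1_sq _ T R nu) gX_le.
have WY (e : R) := limit gY e
  (@continuous_norm2_sq _ T R nu) (@homogeneous_norm2_sq _ T R nu) gY_le.
have measurable_sum g n := @measurable_top_sum _ Omega R P HH (fun w => (X w, Y w)) Z_ k copies g n.
apply: whp_cvg_in_probability.
  near=> n.
  have kn : (0 < k n <= n)%N.
    apply/andP; split; near: n; [exact: k_gt0|exact: (k_le ksmall)].
  have -> : (fun w => rho_hat n (k n) (fun i => (X_ i w, Y_ i w))) = (fun w =>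
      top_sum Z_ k gXY n w / (Num.sqrt (top_sum Z_ k gX n w) * Num.sqrt (top_sum Z_ k gY n w))).
    by apply/funext => w; exact: (rhoE n w).
  apply: measurable_ratio.
  - exact: (measurable_sum gXY n (@continuous_inner _ T R nu) kn).
  - exact: (measurable_sum gX n (@continuous_norm1_sq _ T R nu) kn).
  - exact: (measurable_sum gY n (@continuous_norm2_sq _ T R nu) kn).
move=> e e0; rewrite corrE.
have [delta delta0 H] := ratio_near (tail_integral mu gXY) X_gt0 Y_gt0 e0.
apply: whp_sub (whp_and (whp_and (WXY _ delta0) (WX _ delta0)) (WY _ delta0)) _.
near=> n => w [[h1 h2] h3]; rewrite rhoE.
have s0 : 0 < tail_scale b k n by near: n; exact: (tail_scale_gt0 rvH kinf ksmall).
have k0 : 0 < (k n)%:R :> R by rewrite ltr0n; near: n; exact: k_gt0.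
have c0 : 0 < (k n)%:R * tail_scale b k n ^+ 2 by exact: (mulr_gt0 k0 (exprn_gt0 2 s0)).
have pX : 0 <= top_sum Z_ k gX n w by apply: sumr_ge0 => i _; exact: sqr_ge0.
have pY : 0 <= top_sum Z_ k gY n w by apply: sumr_ge0 => i _; exact: sqr_ge0.
rewrite (ratio_scale _ c0 pX pY).
exact: (H _ _ _ h1 h2 h3).
Unshelve. all: by end_near. Qed.
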